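(* Let $K$ be a field with $\operatorname{char}(K)=0$, $S=K[x_1,\ldots,x_n]$ the standard graded polynomial ring, and $\mathbf{a}=(a_1,\ldots,a_n)$ a vector with $2\leq a_i\leq\infty$ for all $i$. Let $I\subsetneq S$ be an $\mathbf{a}$-stable ideal, $R=S/I$ and $c=\operatorname{codim}(R)$. Then $$e(R)\leq \frac{1}{c!}\prod_{i=1}^{c} M_i,$$ where $M_i=\max\{j\in\mathbb{Z} : \beta^S_{i,j}(R)\neq 0\}$.
   Context: For $u=(u_1,\ldots,u_n)\in\mathbb{N}^n$ write $x^u=x_1^{u_1}\cdots x_n^{u_n}$ and $m(u)=\max\{i\in\{1,\ldots,n\}: u_i\neq 0\}$. For a monomial ideal $I$, $G(I)$ is its unique minimal system of monomial generators. Each $a_i$ is an integer $\geq 2$ or $\infty$ (with $\infty-1=\infty$). A monomial ideal $I\subset S$ is $\mathbf{a}$-bounded if $u_i<a_i$ for all $x^u\in G(I)$ and all $i\in\{1,\ldots,n\}$. It is $\mathbf{a}$-stable if it is $\mathbf{a}$-bounded and, in addition, for all $x^u\in G(I)$ and all $j\leq m(u)$ with $u_j<a_j-1$ one has $x_jx^u/x_{m(u)}\in I$. $S$ is graded by $\deg(x_i)=1$, and $\beta^S_{i,j}(R)=\dim_K\operatorname{Tor}^S_i(R,K)_j$ are the graded Betti numbers; $M_i$ is defined for $1\le i\le \operatorname{projdim}(R)$, and $c\le\operatorname{projdim}(R)$. $e(R)$ denotes the multiplicity of $R$: if $\delta=\dim R>0$, it is $(\delta-1)!$ times the leading coefficient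 of the Hilbert polynomial of $R$ (which has degree $\delta-1$); if $\dim R=0$, it is $\dim_K R$. The codimension is $\operatorname{codim}(R)=n-\dim(R)$. *)

(* Defs.v *)
From HB Require Import structures.
From mathcomp Require Import all_boot all_order all_algebra.
From mathcomp.multinomials Require Import mpoly.

Set Implicit Arguments.
Unset Strict Implicit.
Unset Printing Implicit Defensive.

Import Order.TTheory GRing.Theory Num.Theory.
Local Open Scope ring_scope.
Local Open Scope quotient_scope.

(* An exponent bound is an [option nat], with [None] standing for infinity; *)
(* [omap predn] is then "minus one", with infinity - 1 = infinity.          *)
Definition below_bound (k : nat) (b : option nat) : bool :=
  if b is Some a then (k < a)%N else true.

Definition bound_ge2 (b : option nat) : bool :=
  if b is Some a then (2 <= a)%N else true.

Section StableIdeals.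
Variables (K : fieldType) (n : nat).
Implicit Types (I : {pred {mpoly K[n]}}) (G : {pred 'X_{1..n}}).

Definition monomials_generate G I : Prop :=
  forall f, f \in I <->
    exists (s : seq 'X_{1..n}) (h : 'X_{1..n} -> {mpoly K[n]}),
      {subset s <= G} /\ f = \sum_(u <- s) h u * 'X_[u].

(* G is G(I); in particular I is a monomial ideal. *)
Definition minimal_monomial_generators G I : Prop :=
  monomials_generate G I /\
  forall G' : {pred 'X_{1..n}}, {subset G' <= G} ->
    monomials_generate G' I -> {subset G <= G'}.

(* m = m(u); there is no such m when u = 0. *)
Definition is_max_var (u : 'X_{1..n}) (m : 'I_n) : Prop :=
  u m != 0%N /\ forall k : 'I_n, u k != 0%N -> (k <= m)%N.

Definition bounded_ideal (a : 'I_n -> option nat) I : Prop :=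
  exists2 G, minimal_monomial_generators G I &
    forall u, u \in G -> forall i, below_bound (u i) (a i).

Definition stable_ideal (a : 'I_n -> option nat) I : Prop :=
  bounded_ideal a I /\
  exists2 G, minimal_monomial_generators G I &
    forall u (m j : 'I_n), u \in G -> is_max_var u m -> (j <= m)%N ->
      below_bound (u j) (omap predn (a j)) ->
      'X_[u - U_(m) + U_(j)] \in I.

End StableIdeals.

Section KrullDimension.
Variable R : comNzRingType.

Definition is_prime_ideal (P : {pred R}) : Prop :=
  idealr_closed P /\ prime_idealr_closed P.

(* P 0, ..., P d is a strictly increasing chain of primes, of length d. *)
Definition prime_chain (d : nat) (P : nat -> {pred R}) : Prop :=
  (forall k, (k <= d)%N -> is_prime_ideal (P k)) /\
  (forall k, (k < d)%N ->
     {subset P k <= P k.+1} /\ ~ {subset P k.+1 <= P k}).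

Definition is_krull_dim (d : nat) : Prop :=
  (exists P, prime_chain d P) /\
  (forall e P, prime_chain e P -> (e <= d)%N).

End KrullDimension.

Section Multiplicity.
Variables (K : fieldType) (n : nat) (I : idealr {mpoly K[n]}).
Local Notation R := {ideal_quot I}.

Definition is_codim (c : nat) : Prop :=
  exists2 d, is_krull_dim R d & (c + d = n)%N.

(* k is the dimension of the K-subspace V of R: V has a basis of size k. *)
Definition is_dim (V : R -> Prop) (k : nat) : Prop :=
  exists b : 'I_k -> R,
    (forall i, V (b i)) /\
    (forall x, V x ->
       exists! c : {ffun 'I_k -> K}, x = \sum_i \pi_R (c i)%:MP * b i).

Definition graded_part (d : nat) (x : R) : Prop :=
  exists2 f : {mpoly K[n]}, f \is d.-homog & x = \pi_R f.

Definition is_hilbert_poly (p : {poly rat}) : Prop :=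
  exists d0, forall d, (d0 <= d)%N ->
    exists2 k, is_dim (graded_part d) k & p.[d%:R] = k%:R.

Definition is_multiplicity (e : rat) : Prop :=
  exists2 d, is_krull_dim R d &
    if d is d'.+1 then
      exists2 p, is_hilbert_poly p & e = d'`!%:R * lead_coef p
    else exists2 k, is_dim (fun _ => True) k & e = k%:R.

End Multiplicity.

Section Betti.
Variables (K : fieldType) (n : nat).
Local Notation S := {mpoly K[n]}.

(* The data of a sequence ... -> F_1 -> F_0 of graded free S-modules of      *)
(* finite rank, F_i being the sum over k of S(- gf_shift i k). Elements of   *)
(* F_i are row vectors, and the map F_(i+1) -> F_i is v |-> v *m gf_diff i.  *)
Record graded_free_seq := GradedFreeSeq {
  gf_rank : nat -> nat;
  gf_shift : forall i, 'I_(gf_rank i) -> int;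
  gf_diff : forall i, 'M[S]_(gf_rank i.+1, gf_rank i)
}.

(* f is zero or homogeneous of degree d; only 0 qualifies when d < 0. *)
Definition int_homog (d : int) (f : S) : Prop :=
  forall m, m \in msupp f -> (mdeg m)%:Z = d.

Section Resolution.
Variables (I : idealr S) (F : graded_free_seq).
Local Notation R := {ideal_quot I}.

(* All maps, including the augmentation F_0 -> R sending the k-th basis      *)
(* vector to eps k, have degree 0, and ... -> F_1 -> F_0 -> R -> 0 is exact. *)
Definition is_graded_free_resolution : Prop :=
  (forall i k l,
     int_homog (gf_shift k - gf_shift l) (gf_diff F i k l)) /\
  (forall i (v : 'rV[S]_(gf_rank F i.+1)),
     v *m gf_diff F i = 0 <-> exists w, v = w *m gf_diff F i.+1) /\
  exists eps : 'I_(gf_rank F 0) -> R,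
    [/\ forall k, exists2 f, int_homog (gf_shift k) f & eps k = \pi_R f,
        forall x, exists v : 'rV[S]_(gf_rank F 0),
          x = \sum_k \pi_R (v 0 k) * eps k
      & forall v : 'rV[S]_(gf_rank F 0),
          \sum_k \pi_R (v 0 k) * eps k = 0 <->
          exists w, v = w *m gf_diff F 0].

End Resolution.

Section Tor.
Variable F : graded_free_seq.

(* Tensoring with K = S/(x_1,...,x_n) replaces each entry of a differential  *)
(* by its constant coefficient.                                              *)
Definition diff_tensor i : 'M[K]_(gf_rank F i.+1, gf_rank F i) :=
  map_mx (mcoeff 0%MM) (gf_diff F i).

Definition cycles i : 'M[K]_(gf_rank F i) :=
  if i is i'.+1 then kermx (diff_tensor i') else 1%:M.

(* Its row space is the degree j component of F_i (x) K. *)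
Definition degree_part i (j : int) : 'M[K]_(gf_rank F i) :=
  diag_mx (\row_k (gf_shift k == j)%:R).

(* dim_K H_i(F (x) K)_j *)
Definition tor_dim i (j : int) : nat :=
  \rank (cycles i :&: degree_part i j)%MS -
  \rank (diff_tensor i :&: degree_part i j)%MS.

End Tor.

(* b = dim_K Tor_i(S/I, K)_j, computed from some graded free resolution of   *)
(* S/I; the value does not depend on the resolution.                         *)
Definition is_graded_betti (I : idealr S) (i : nat) (j : int) (b : nat) :=
  exists2 F, is_graded_free_resolution I F & tor_dim F i j = b.

Definition betti_neq0 (I : idealr S) (i : nat) (j : int) : Prop :=
  exists2 b, is_graded_betti I i j b & b != 0%N.

Definition is_max_shift (I : idealr S) (i : nat) (M : int) : Prop :=
  betti_neq0 I i M /\ forall j, betti_neq0 I i j -> j <= M.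

End Betti.

(* Main.v *)
Require Import Defs.
From HB Require Import structures.
From mathcomp Require Import all_boot all_order all_algebra.
From mathcomp.multinomials Require Import mpoly.
From mathcomp Require Import zify ring.
From Stdlib Require Import Classical_Prop.

Set Implicit Arguments.
Unset Strict Implicit.
Unset Printing Implicit Defensive.

Import Order.TTheory GRing.Theory Num.Theory.
Local Open Scope ring_scope.
Local Open Scope quotient_scope.

(** Let U be the set of exponents of monomials in I. Replacing an infinite
    bound by a number above all exponents of minimal generators (Dickson's
    lemma) gives finite numbers b_i such that every minimal generator u
    satisfies u <= b, and such that x_j x^u / x_m(u) is in I whenever j < m(u)
    and u_j < b_j. Membership in I then depends only on the exponent truncated
    at b. Call a truncated exponent v outside U standard, and call i a defect of
    v when v_i < b_i: on the other variables the exponent may grow freely.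
    Let h be the smallest number of defects of a standard v.

    Sorting the monomials outside I by their truncation gives the Hilbert
    function of R as a sum of binomial coefficients, one for each standard v,
    of degree n - 1 minus the number of defects of v (size_stdmons). Hence e(R)
    is the number of standard v with exactly h defects (hilbert_poly_lead,
    artinian_dim). The same sorting bounds the number of monomials of degree at
    most T outside I by a multiple of T^(n-h); this bounds the length of chains
    of primes, since a chain of length d yields about s^d elements of degree
    O(s) that are linearly independent modulo I (chain_independent). Chains of
    length n - h come from primes generated by variables. So codim R = h
    (krull_dimE).

    Among the generators u with at least h - 1 variables j < m(u) such that
    u_j < b_j, take one of the largest degree d. If v is standard with h defects
    and k is its last defect, the exchange property forces
    v_1 + ... + v_k < d (prefix_bound): otherwise a generator below the monomial
    obtained by filling the k-th exponent of v up to b_k can be pushed, by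
    exchanges, to one below v. Recording the partial sums of v at its defects is
    injective, so there are at most binom(d + h - 1, h) such v
    (card_prefix_bounded), and this binomial is the product of d, d + 1, ...,
    d + h - 1 divided by h!.

    It remains to see that M_i >= d + i - 1 for 1 <= i <= h. Let u be the chosen
    generator, m = m(u), and s a set of i - 1 variables j < m with u_j < b_j.
    The Koszul chain (x^u / x_m) e_s e_m is a cycle modulo I of degree
    d + i - 1. It is not a boundary modulo I: its differential has the
    coefficient x^u (up to sign) at e_s, while the differential of a chain with
    coefficients in I has all its coefficients in (x_1, ..., x_n) I
    (generator_tor). The Koszul class is carried to the homology of F (x) K, for
    an arbitrary graded free resolution F, by the usual zigzag in the double
    complex of F and the Koszul complex (zigzag_step). That step needs exactness
    of the Koszul complex over the polynomial ring, which in characteristic zero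
    follows from Euler's formula: the exterior derivative is a homotopy between
    zero and multiplication by the total degree (koszul_homotopy). *)

(** * Monomial ideals and their minimal generators *)

Section UpSets.
Variables (n : nat) (U : pred 'X_{1..n}).
Implicit Types (m u v : 'X_{1..n}).
Hypothesis upU : forall m m', (m <= m')%MM -> U m -> U m'.

Definition mingen u : bool :=
  U u && [forall k, (u k != 0%N) ==> ~~ U (u - U_(k))%MM].

Lemma mdeg_subU u k : u k != 0%N -> (mdeg (u - U_(k))).+1 = mdeg u.
Proof.
by rewrite -lep1mP => /submK {2}<-; rewrite mdegD mdeg1 addn1.
Qed.

Lemma mingen_below m : U m -> exists2 u, mingen u & (u <= m)%MM.
Proof.
have [d] := ubnP (mdeg m); elim: d m => // d IH m le_d Um.
have [gm|] := boolP (mingen m); first by exists m; rewrite ?lepm_refl.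
rewrite /mingen Um /= => /forallPn[k]; rewrite negb_imply negbK => /andP[mk Umk].
have [|u gu le_u] := IH _ _ Umk; first by have := mdeg_subU mk; lia.
by exists u => //; apply: lepm_trans le_u (lem_subr _ _).
Qed.

Lemma mingen_minimal u v : mingen u -> (v <= u)%MM -> U v -> v = u.
Proof.
case/andP=> _ /forallP min_u le_vu Uv; apply/mnmP=> k; apply/eqP.
rewrite eqn_leq (mnm_lepP le_vu) /= leqNgt; apply/negP => lt_vu.
have uk : u k != 0%N by lia.
have := min_u k; rewrite uk /= => /negP; apply; apply: upU Uv.
apply/mnm_lepP=> i; rewrite mnmBE mnm1E; have := mnm_lepP le_vu i.
by case: eqP => [<-|] /=; lia.
Qed.

End UpSets.

Section MonomialIdeals.
Variables (K : fieldType) (n : nat) (I : idealr {mpoly K[n]}).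
Implicit Types (m u v : 'X_{1..n}) (G : {pred 'X_{1..n}}).

Definition mons : pred 'X_{1..n} := fun m => 'X_[m] \in I.

Definition monomial_ideal : Prop :=
  forall f m, f \in I -> m \in msupp f -> mons m.

Lemma mons_up m m' : (m <= m')%MM -> mons m -> mons m'.
Proof. by rewrite /mons => /submK <- mI; rewrite mpolyXD; apply: idealMr. Qed.

Section Generated.
Variable G : {pred 'X_{1..n}}.
Hypothesis genG : monomials_generate G I.

Lemma generator_in_ideal u : u \in G -> 'X_[u] \in I.
Proof.
move=> uG; apply/genG; exists [:: u], (fun=> 1); split.
  by move=> v; rewrite inE => /eqP->.
by rewrite big_seq1 mul1r.
Qed.

Lemma generator_below f m : f \in I -> m \in msupp f ->
  exists2 u, u \in G & (u <= m)%MM.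
Proof.
case/genG=> s [h [sG ->]] /msupp_sum_le/flatten_mapP[u].
rewrite filter_predT => us; rewrite mulrC => /msuppM_le /allpairsP[[m1 m2] /= []].
rewrite msuppX inE => /eqP-> _ ->; exists u; first exact: sG.
exact: lem_addr.
Qed.

Lemma generated_monomial_ideal : monomial_ideal.
Proof.
move=> f m fI mf; have [u /generator_in_ideal uI le_um] := generator_below fI mf.
exact: mons_up le_um uI.
Qed.

End Generated.

Lemma monomial_idealP f : monomial_ideal ->
  (forall m, m \in msupp f -> mons m) <-> f \in I.
Proof.
move=> monI; split=> [sf|fI m mf]; last exact: monI mf.
rewrite (mpolyE f) big_seq; apply: rpred_sum => m mf.
by rewrite -mul_mpolyC; apply: idealMr; apply: sf.
Qed.

(** The terms of f divisible by the same chosen generator are collected into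
    one cofactor. *)
Lemma monomials_below_generate (G : {pred 'X_{1..n}}) f :
    (forall m, m \in msupp f -> exists2 u, u \in G & (u <= m)%MM) ->
  exists (s : seq 'X_{1..n}) (h : 'X_{1..n} -> {mpoly K[n]}),
    {subset s <= G} /\ f = \sum_(u <- s) h u * 'X_[u].
Proof.
move=> below; have [g gP] : exists g : 'X_{1..n} -> 'X_{1..n},
    forall m, m \in msupp f -> (g m \in G) && (g m <= m)%MM.
  elim: (msupp f) below => [|m l IH] below; first by exists id.
  have [|g gP] := IH; first by move=> k kl; apply: below; rewrite inE kl orbT.
  have [u uG le_um] := below m (mem_head _ _).
  exists (fun k => if k == m then u else g k) => k; rewrite inE.
  by case: eqP => [-> _|_ /gP //]; rewrite uG.
exists (undup (map g (msupp f))).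
exists (fun u => \sum_(m <- msupp f | g m == u) f@_m *: 'X_[m - u]); split.
  by move=> u; rewrite mem_undup => /mapP[m /gP/andP[gG _] ->].
rewrite [LHS]mpolyE.
under [RHS]eq_bigr => u _ do rewrite mulr_suml.
under [RHS]eq_bigr => u _ do rewrite big_mkcond.
rewrite exchange_big big_seq [RHS]big_seq /=; apply: eq_bigr => m mf.
rewrite -big_mkcond (big_rem (g m)) /=; last first.
  by rewrite mem_undup map_f.
rewrite eqxx big1_seq ?addr0 => [|u]; last first.
  case/andP=> /eqP<-; rewrite (rem_filter _ (undup_uniq _)) mem_filter /=.
  by rewrite eqxx.
by have /andP[_ le_gm] := gP m mf; rewrite -scalerAl -mpolyXD submK.
Qed.

(** The minimal elements of the up-set that lie in G still generate I, so the
    minimality of G leaves nothing else in G; conversely any generating set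
    contains every minimal element. *)
Lemma minimal_generatorsE G :
  minimal_monomial_generators G I -> G =i mingen mons.
Proof.
case=> genG minG u; apply/idP/idP=> [|gu]; last first.
  have /andP[uI _] : mingen mons u by [].
  have [|v vG le_vu] := @generator_below G genG _ u uI; first by rewrite msuppX mem_head.
  by rewrite -(mingen_minimal mons_up gu le_vu (generator_in_ideal genG vG)).
have sGG : {subset [predI G & mingen mons] <= G} by move=> v /andP[].
move=> uG; suff /(minG _ sGG)/(_ u uG)/andP[] :
    monomials_generate [predI G & mingen mons] I by [].
move=> f; split=> [fI|[s [h [sG ->]]]]; last first.
  by apply/genG; exists s, h; split=> // v /sG/sGG.
apply: monomials_below_generate => m mf.
have [v gv le_vm] := mingen_below (generated_monomial_ideal genG fI mf).
exists v; rewrite // inE /= [v \in mingen mons]gv andbT; have /andP[vI _] := gv.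
have [|w wG le_wv] := @generator_below G genG _ v vI; first by rewrite msuppX mem_head.
by rewrite -(mingen_minimal mons_up gv le_wv (generator_in_ideal genG wG)).
Qed.
End MonomialIdeals.

(** * Dickson's lemma *)

Section Dickson.
Variable n : nat.
Implicit Types (m u v : 'X_{1..n}) (V : {set 'I_n}) (U : 'X_{1..n} -> Prop).

Definition cap (D : nat) m : 'X_{1..n} := [multinom minn (m i) D | i < n].

Definition up_closed U := forall m m', (m <= m')%MM -> U m -> U m'.

Definition supported V m := forall i, i \notin V -> m i = 0%N.

Definition set_coord m k c : 'X_{1..n} := [multinom if i == k then c else m i | i < n].

Lemma finite_bound (T : finType) (P : T -> nat -> Prop) :
    (forall x c c', (c <= c')%N -> P x c -> P x c') ->
    (forall x, exists c, P x c) ->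
  exists C, forall x, P x C.
Proof.
move=> monoP exP.
suff [C CP] : exists C, forall x, x \in enum T -> P x C.
  by exists C => x; apply: CP; rewrite mem_enum.
elim: (enum T) => [|x l [C IH]]; first by exists 0%N.
have [c Pc] := exP x; exists (maxn c C) => y; rewrite inE => /predU1P[->|/IH].
  by apply: monoP Pc; apply: leq_maxl.
by apply: monoP; apply: leq_maxr.
Qed.

(** By induction on the set V of variables that may occur. For x in V, slice U by
    the value of the exponent of x: the slices increase, the induction hypothesis
    truncates their union, and only finitely many truncated exponents occur
    there, so from some value C on the slices contain them all; the slices before
    C are finitely many and are truncated one by one. *)
Lemma dickson U : up_closed U -> exists D, forall m, U m -> U (cap D m).
Proof.
move=> upU; suff [D DP] : exists D, forall m, supported setT m -> U m -> U (cap D m).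
  by exists D => m; apply: DP => i; rewrite inE.
move: [set: 'I_n] => V; have [k] := ubnP #|V|.
elim: k V U upU => // k IH V U upU ltVk.
have [->|[x xV]] := set_0Vmem V.
  exists 0%N => m supm; congr U; apply/mnmP=> i; rewrite mnmE minn0.
  by rewrite supm ?inE.
have upS c : up_closed (fun m => U (set_coord m x c)).
  move=> m m' le_mm'; apply: upU; apply/mnm_lepP=> i; rewrite !mnmE.
  by case: eqP => // _; apply: (mnm_lepP le_mm').
have {}IH (W : 'X_{1..n} -> Prop) : up_closed W ->
    exists D, forall m, supported (V :\ x) m -> W m -> W (cap D m).
  by move=> upW; apply: IH upW _; rewrite (cardsD1 x V) xV in ltVk.
have [|D1 D1P] := IH (fun m => exists c, U (set_coord m x c)).
  by move=> m m' le_mm' [c Uc]; exists c; apply: upS le_mm' Uc.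
pose mono (g : {ffun 'I_n -> 'I_D1.+1}) := [multinom (g i : nat) | i < n].
(* A value from which the slices have reached their union on the box [0, D1]. *)
have [C CP] : exists C, forall g,
    (exists c, U (set_coord (mono g) x c)) -> U (set_coord (mono g) x C).
  apply: (finite_bound (P := fun g C => (exists c, U (set_coord (mono g) x c)) ->
    U (set_coord (mono g) x C))) => [g c c' le_cc' imp ex|g].
    apply: upU (imp ex); apply/mnm_lepP=> i; rewrite !mnmE.
    by case: eqP.
  have [[c Uc]|no] := classic (exists c, U (set_coord (mono g) x c)).
    by exists c.
  by exists 0%N => /no.
have [D2 D2P] : exists D, forall c : 'I_C, forall m, supported (V :\ x) m ->
    U (set_coord m x c) -> U (set_coord (cap D m) x c).
  apply: (finite_bound (P := fun (c : 'I_C) D => forall m, supported (V :\ x) m ->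
    U (set_coord m x c) -> U (set_coord (cap D m) x c))) => [c D D' le_DD' imp m sm Um|c].
    by apply: upS (imp m sm Um); apply/mnm_lepP=> i; rewrite !mnmE; lia.
  exact: IH (upS c).
exists (maxn D1 (maxn C D2)) => m supm Um.
have set0K c : set_coord (set_coord m x 0) x c = set_coord m x c.
  by apply/mnmP=> i; rewrite !mnmE; case: eqP.
have mE : m = set_coord m x (m x) by apply/mnmP=> i; rewrite mnmE; case: eqP => [->|].
have sup0 : supported (V :\ x) (set_coord m x 0).
  by move=> i; rewrite mnmE !inE negb_and negbK; case: eqP => //= _ /supm.
have [lt_C|le_C] := ltnP (m x) C.
  have := D2P (Ordinal lt_C) _ sup0; rewrite /= set0K -mE => /(_ Um).
  apply: upU; apply/mnm_lepP=> i; rewrite !mnmE; case: eqP => [->|_]; lia.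
have UI : exists c, U (set_coord (set_coord m x 0) x c).
  by exists (m x); rewrite set0K -mE.
have /CP UC : exists c, U (set_coord (mono [ffun i => inord (minn (set_coord m x 0 i)
  D1)]) x c).
  have [c Uc] := D1P _ sup0 UI; exists c; congr U: Uc; apply/mnmP=> i.
  by rewrite !mnmE ffunE inordK ?ltnS ?geq_minr // mnmE.
apply: upU UC; apply/mnm_lepP=> i; rewrite !mnmE ffunE inordK ?ltnS ?geq_minr // mnmE.
by case: eqP => [->|_]; lia.
Qed.
End Dickson.

(** * Standard monomials with the fewest defects *)

Section Counting.
Variables (n : nat) (b : 'I_n -> nat) (U : pred 'X_{1..n}).
Implicit Types (m u v w : 'X_{1..n}) (i j k : 'I_n).

Definition defects v : {set 'I_n} := [set i | v i < b i]%N.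

(** The exponent b i stands for every exponent at least b i; these finitely many
    monomials therefore describe the complement of U. *)
Definition standard : {set 'X_{1..n < (\sum_i b i).+1}} :=
  [set v : 'X_{1..n < _} | [forall i, v i <= b i]%N && ~~ U v].

(** The bound on the number of free variables before the last variable of u is
    what lets u contribute Koszul classes in homological degrees 1 to h. *)
Definition good (h : nat) u : bool :=
  mingen U u && [exists m : 'I_n, [&& u m != 0%N, [forall k, (u k != 0%N) ==> (k <= m)%N]
    & (h <= #|[set j in defects u | (j < m)%N]|.+1)%N]].

Hypothesis upU : forall m m', (m <= m')%MM -> U m -> U m'.
Hypothesis mingen_le : forall u i, mingen U u -> (u i <= b i)%N.
Hypothesis exchange : forall u k j, mingen U u -> is_max_var u k -> (j < k)%N ->
  (u j < b j)%N -> U (u - U_(k) + U_(j))%MM.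

Definition trunc m : 'X_{1..n} := [multinom minn (m i) (b i) | i < n].

(** Minimal generators are bounded by b, so truncation at b does not change which
    of them divide m. *)
Lemma trunc_up m : U (trunc m) = U m.
Proof.
apply/idP/idP=> [|Um].
  by apply: upU; apply/mnm_lepP=> i; rewrite mnmE geq_minl.
have [u gu le_um] := mingen_below Um; have /andP[Uu _] := gu.
apply: upU Uu; apply/mnm_lepP=> i.
by rewrite mnmE leq_min (mnm_lepP le_um) mingen_le.
Qed.

Lemma mem_box m : (forall i, m i <= b i)%N -> (mdeg m < (\sum_i b i).+1)%N.
Proof. by move=> le_mb; rewrite mdegE ltnS leq_sum. Qed.

Lemma standardP m : (forall i, m i <= b i)%N -> ~~ U m ->
  exists2 v : 'X_{1..n < (\sum_i b i).+1}, v \in standard & m = v.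
Proof.
move=> le_mb Um; exists (BMultinom (mem_box le_mb)) => //.
by rewrite inE Um andbT; apply/forallP.
Qed.

Lemma exists_max_var u : u != 0%MM -> exists m : 'I_n, is_max_var u m.
Proof.
move=> u0; have [k uk] : exists k, u k != 0%N.
  apply/existsP; apply: contraNT u0 => /existsPn u0; apply/eqP/mnmP=> i.
  by rewrite mnm0E; apply/eqP; rewrite -[_ == _]negbK u0.
case: (@arg_maxnP _ k (fun k => u k != 0%N) (fun k : 'I_n => k : nat) uk) => m um max_m.
by exists m.
Qed.

Section Prefix.
Variables (h : nat) (v : 'X_{1..n}) (k : 'I_n).
Hypothesis min_defects : forall w, (forall i, w i <= b i)%N -> ~~ U w ->
  (h <= #|defects w|)%N.
Hypothesis v_box : forall i, (v i <= b i)%N.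
Hypothesis v_std : ~~ U v.
Hypothesis v_def : #|defects v| = h.
Hypothesis k_def : k \in defects v.
Hypothesis k_max : forall i, i \in defects v -> (i <= k)%N.

(** Filling the last defect of v leaves h - 1 defects, so the result is in U;
    the generators dividing it are the ones that control v. *)
Definition fill : 'X_{1..n} := [multinom if i == k then b i else v i | i < n].

Lemma fill_up : U fill.
Proof.
apply: contraT => /min_defects; rewrite -v_def (cardsD1 k) k_def add1n.
move=> lt; have /lt : forall i, (fill i <= b i)%N.
  by move=> i; rewrite mnmE; case: eqP.
rewrite ltnNge subset_leq_card //; apply/subsetP=> i.
by rewrite !inE mnmE; case: eqP => //=; rewrite ltnn.
Qed.

Lemma below_fill u : U u -> (u <= fill)%MM -> (v k < u k)%N.
Proof.
move=> Uu le_u; rewrite ltnNge; apply: contra v_std => le_k.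
apply: upU Uu; apply/mnm_lepP=> i; have := mnm_lepP le_u i; rewrite mnmE.
by case: eqP => [->|].
Qed.

(** Such a u does not divide v, hence involves x_k or a later variable, and
    every defect of v other than k lies before k and is free for u. *)
Lemma good_below_fill u : mingen U u -> (u <= fill)%MM -> good h u.
Proof.
move=> gu le_u; have /andP[Uu _] := gu; have lt_k := below_fill Uu le_u.
have [|m [um max_m]] := @exists_max_var u.
  by apply: contraTneq lt_k => ->; rewrite mnm0E.
rewrite /good gu; apply/existsP; exists m; rewrite um /=; apply/andP; split.
  by apply/forallP=> i; apply/implyP/max_m.
have le_km : (k <= m)%N by apply: max_m; lia.
rewrite -v_def (cardsD1 k) k_def add1n ltnS subset_leq_card //.
apply/subsetP=> i; rewrite !inE => /andP[ik lt_i].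
have le_ik : (i <= k)%N by apply: k_max; rewrite inE.
have := mnm_lepP le_u i; rewrite mnmE (negbTE ik) => le_i.
have : (i != k :> nat) by []. 
lia.
Qed.

Lemma exists_good : exists u, good h u.
Proof.
have [u gu le_u] := mingen_below fill_up.
by exists u; apply: good_below_fill.
Qed.

(** If the exponents of v up to k added up to d or more, every generator u below
    fill would satisfy u_j < v_j for some j < k, because its degree is at most d
    and u_k > v_k. Exchanging its last variable for x_j stays below fill and
    lowers the part of the degree carried by the variables from k on; this
    cannot go on forever. *)
Lemma prefix_bound d : (forall u, good h u -> mdeg u <= d)%N ->
  (\sum_(i < n | (i <= k)%N) v i < d)%N.
Proof.
move=> le_d; rewrite ltnNge; apply/negP => le_dv.
suff no_gen N u : mingen U u -> (u <= fill)%MM -> (\sum_(i < n | k <= i) u i < N)%N ->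
  False.
  by have [u gu le_u] := mingen_below fill_up; apply: no_gen gu le_u (ltnSn _).
elim: N u => // N IH u gu le_u lt_N.
have /andP[Uu _] := gu; have lt_k := below_fill Uu le_u.
have [|m max_m] := @exists_max_var u.
  by apply: contraTneq lt_k => ->; rewrite mnm0E.
have le_km : (k <= m)%N by apply: max_m.2; lia.
have [j lt_jk lt_uv] : exists2 j : 'I_n, (j < k)%N & (u j < v j)%N.
  apply/exists_inP; apply: contraT => /exists_inPn le_vu.
  have := le_d u (good_below_fill gu le_u); rewrite leqNgt => /negP[].
  apply: leq_ltn_trans le_dv _.
  rewrite mdegE [X in (_ < X)%N](bigID (fun i : 'I_n => (i <= k)%N)) /=.
  apply: leq_trans (leq_addr _ _).
  rewrite (bigD1 k) //= [X in (_ < X)%N](bigD1 k) //=.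
  rewrite -addSn leq_add // leq_sum // => i /andP[le_ik ik].
  by rewrite leqNgt; apply: le_vu; rewrite unfold_in; have : (i != k :> nat) by []; lia.
have lt_jb : (u j < b j)%N by apply: leq_trans lt_uv (v_box _).
have lt_jm : (j < m)%N by apply: leq_trans le_km.
have Ux := exchange gu max_m lt_jm lt_jb.
have [u' gu' le_u'] := mingen_below Ux.
have xE i : (u - U_(m) + U_(j))%MM i = (u i - (m == i) + (j == i))%N.
  by rewrite mnmDE mnmBE !mnm1E.
apply: (IH u' gu').
  apply: lepm_trans le_u' _; apply/mnm_lepP=> i; rewrite xE.
  have := mnm_lepP le_u i; rewrite [fill i]mnmE; case: (j =P i) => [<-|_] /=.
    by rewrite -[j == k]/(j == k :> nat); case: eqP; lia.
  lia.
apply: leq_trans (_ : _ <= (\sum_(i < n | k <= i) (u - U_(m) + U_(j))%MM i).+1)%N _.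
  by rewrite ltnS leq_sum // => i _; apply: (mnm_lepP le_u').
rewrite (bigD1 m) //=; rewrite (bigD1 m) //= ltnS in lt_N.
apply: leq_trans lt_N; rewrite -addSn leq_add //.
  rewrite xE eqxx (negbTE (_ : j != m)) //; first by have [um _] := max_m; lia.
  by apply: contraTneq lt_jm => ->; rewrite ltnn.
apply: leq_sum => i /andP[le_ki _]; rewrite xE (negbTE (_ : j != i)); first lia.
by apply: contraTneq lt_jk => ->; rewrite -leqNgt.
Qed.

End Prefix.

(** Partial sums of v, shifted by the rank among the defects to make them strictly
    increasing along the defects. *)
Definition pos v i : nat :=
  (\sum_(l < n | (l <= i)%N) v l + #|[set l in defects v | (l < i)%N]|)%N.

Lemma pos_mono v i j : i \in defects v -> (i < j)%N -> (pos v i < pos v j)%N.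
Proof.
move=> di lt_ij; rewrite /pos -addnS leq_add //.
  rewrite [X in (_ <= X)%N](bigID (fun l : 'I_n => (l <= i)%N)) /=.
  apply: leq_trans (leq_addr _ _); rewrite leq_eqVlt; apply/orP; left; apply/eqP.
  by apply: eq_bigl => l; apply/idP/andP => [|[]//]; split=> //; lia.
rewrite [X in (_ <= X)%N](cardsD1 i) inE di lt_ij ltnS subset_leq_card //.
apply/subsetP=> l; rewrite !inE => /andP[-> lt_li] /=.
by rewrite -[l == i]/(l == i :> nat); lia.
Qed.

(** At the first index i where v and w differ, say v_i < w_i, the index i is a
    defect of v; its position lies strictly between the positions of the earlier
    defects, which v and w share, and those of the later defects of w. *)
Lemma pos_inj v w : (forall x, (exists2 i, i \in defects v & x = pos v i) <->
    (exists2 i, i \in defects w & x = pos w i)) ->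
  (forall i, v i <= b i)%N -> (forall i, w i <= b i)%N -> v = w.
Proof.
suff main v' w' : (forall x, (exists2 i, i \in defects v' & x = pos v' i) ->
    (exists2 i, i \in defects w' & x = pos w' i)) -> (forall i, w' i <= b i)%N ->
    forall i, (forall l : 'I_n, (l < i)%N -> v' l = w' l) -> ~~ (v' i < w' i)%N.
  move=> eqvw vb wb; apply/mnmP=> i; have [N] := ubnP i; elim: N i => // N IH i.
  rewrite ltnS => le_iN.
  have eq_l (l : 'I_n) : (l < i)%N -> v l = w l by move=> ?; apply: IH; lia.
  have := main v w (fun x => (eqvw x).1) wb i eq_l.
  have := main w v (fun x => (eqvw x).2) vb i (fun l lt => esym (eq_l l lt)).
  lia.
move=> sub wb i eq_l; apply/negP => lt_i.
have di : i \in defects v' by rewrite inE (leq_trans lt_i).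
have [j dj] := sub _ (ex_intro2 _ _ i di erefl).
have split_sum (u : 'X_{1..n}) (k : 'I_n) : (\sum_(l < n | (l <= k)%N) u l =
    \sum_(l < n | (l < k)%N) u l + u k)%N.
  rewrite (bigD1 k) //= addnC; congr (_ + _)%N; apply: eq_bigl => l.
  by rewrite -[l == k]/(l == k :> nat); lia.
have eq_sum (k : 'I_n) : (k <= i)%N ->
  (\sum_(l < n | (l < k)%N) v' l = \sum_(l < n | (l < k)%N) w' l)%N.
  by move=> le_ki; apply: eq_bigr => l lt_lk; apply: eq_l; lia.
have eq_card (k : 'I_n) : (k <= i)%N ->
  [set l in defects v' | (l < k)%N] = [set l in defects w' | (l < k)%N].
  move=> le_ki; apply/setP=> l; rewrite !inE; case: (ltnP l k) => lt_lk;
    rewrite ?andbF // eq_l //.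
  lia.
have [lt_ji|le_ij] := ltnP j i => eq_pos.
  have lt : (pos v' j < pos v' i)%N.
    by apply: pos_mono (lt_ji); move: dj; rewrite !inE eq_l.
  have le_ji : (j <= i)%N by apply: ltnW.
  by move: lt; rewrite eq_pos /pos !split_sum eq_sum // eq_card // eq_l // ltnn.
suff : (pos v' i < pos w' j)%N by rewrite eq_pos ltnn.
apply: leq_trans (_ : pos w' i <= _)%N.
  by rewrite /pos !split_sum eq_sum // eq_card // ltn_add2r ltn_add2l.
rewrite /pos leq_add //.
  rewrite [X in (_ <= X)%N](bigID (fun l : 'I_n => (l <= i)%N)) /=.
  apply: leq_trans (leq_addr _ _); rewrite leq_eqVlt; apply/orP; left; apply/eqP.
  by apply: eq_bigl => l; apply/idP/andP => [|[]//]; split=> //; lia.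
by apply: subset_leq_card; apply/subsetP=> l; rewrite !inE => /andP[->] /=; lia.
Qed.

(** The positions of the defects form an h-element subset of a set with d + h - 1
    elements, and this subset determines v. *)
Lemma card_prefix_bounded (A : {set 'X_{1..n < (\sum_i b i).+1}}) h d :
    (forall v : 'X_{1..n < _}, v \in A -> (forall i, v i <= b i)%N /\ #|defects v| = h) ->
    (forall (v : 'X_{1..n < _}) k, v \in A -> k \in defects v ->
      (forall i, i \in defects v -> (i <= k)%N) -> (\sum_(i < n | (i <= k)%N) v i < d)%N) ->
  (#|A| <= 'C((d + h).-1, h))%N.
Proof.
move=> A_h A_d; pose code (v : 'X_{1..n < (\sum_i b i).+1}) :=
  [set x : 'I_(d + h).-1 | [exists i in defects v, x == pos v i :> nat]].
have code_lt (v : 'X_{1..n < _}) i : v \in A -> i \in defects v -> (pos v i < (d + h).-1)%N.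
  move=> vA iv; have [vb vh] := A_h v vA.
  case: (@arg_maxnP _ i (mem (defects v)) (fun k : 'I_n => k : nat) iv) => k dk' max_k.
  have dk : k \in defects v by []; clear dk'.
  apply: leq_ltn_trans (_ : pos v k < _)%N.
    have [->//|ne] := eqVneq i k; apply/ltnW/pos_mono => //.
    by have := max_k _ iv; have : (i != k :> nat) by []; rewrite /=; lia.
  have := A_d v k vA dk max_k; rewrite /pos.
  have : (#|[set l in defects v | (l < k)%N]| < h)%N.
    rewrite -vh [X in (_ < X)%N](cardsD1 k) dk ltnS subset_leq_card //.
    apply/subsetP=> l; rewrite !inE => /andP[-> lt_lk].
    by rewrite -[l == k]/(l == k :> nat); lia.
  lia.
have codeP (v : 'X_{1..n < _}) x : v \in A ->
    (exists2 i, i \in defects v & x = pos v i) <-> (exists2 y, y \in code v & x = y).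
  move=> vA; split=> [[i iv ->]|[y]].
    exists (Ordinal (code_lt v i vA iv)) => //; rewrite inE.
    by apply/exists_inP; exists i.
  by rewrite inE => /exists_inP[i iv /eqP yE] ->; exists i.
have code_inj : {in A &, injective code}.
  move=> v w vA wA eq_code; apply: val_inj; apply: pos_inj => [x||] /=.
  - by rewrite (codeP v) // (codeP w) // eq_code.
  - by have [] := A_h v vA.
  - by have [] := A_h w wA.
rewrite -(card_in_imset code_inj) -[X in 'C(X, _)](card_ord) -card_draws subset_leq_card //.
apply/subsetP=> _ /imsetP[v vA ->]; rewrite inE; have [_ vh] := A_h v vA.
have pinj : {in defects v &, injective (pos v)}.
  move=> i j iv jv eq_pos; case: (ltngtP i j) => [lt|lt|/ord_inj//].
    by have := pos_mono iv lt; rewrite eq_pos ltnn.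
  by have := pos_mono jv lt; rewrite eq_pos ltnn.
rewrite -[X in _ == X]vh; pose f (i : 'I_n) : option 'I_(d + h).-1 := insub (pos v i).
rewrite -(card_imset _ (@Some_inj _)) -(@card_in_imset _ _ f) => [|i j iv jv].
  apply/eqP; congr #|pred_of_set _|; apply/setP=> o; apply/imsetP/imsetP=> [[x]|[i iv ->]].
    rewrite inE => /exists_inP[i iv /eqP xE] ->; exists i => //.
    by rewrite /f -xE valK.
  exists (Ordinal (code_lt v i vA iv)).
    by rewrite inE; apply/exists_inP; exists i.
  by rewrite /f insubT ?code_lt // => lt; congr Some; apply: val_inj.
by rewrite /f !insubT ?code_lt // => li lj [eq_pos]; apply: pinj.
Qed.

End Counting.

(** * The Hilbert function in terms of standard monomials *)

Section MonomialsOfDegree.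
Variable n : nat.

Definition monos d : seq 'X_{1..n} := [seq s2m t | t : d.-tuple 'I_n <- enum (basis n d)].

Lemma mem_monos d m : (m \in monos d) = (mdeg m == d).
Proof. by rewrite basis_cover. Qed.

Lemma monos_uniq d : uniq (monos d).
Proof. exact: uniq_basis. Qed.

End MonomialsOfDegree.

Lemma size_monos_gt0 f d : (0 < f)%N -> size (monos f d) = 'C(d + f.-1, f.-1).
Proof.
by case: f => // f _; rewrite size_basis -bin_sub ?leq_addr // addKn.
Qed.

Lemma monos_no_var d : (0 < d)%N -> monos 0 d = [::].
Proof.
move=> d_gt0; case E: (monos 0 d) => [//|m s].
have : m \in monos 0 d by rewrite E mem_head.
by rewrite mem_monos mdegE big_ord0 => /eqP dE; rewrite -dE in d_gt0.
Qed.

Section Fibers.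
Variables (n : nat) (b : 'I_n -> nat).
Implicit Types (m v : 'X_{1..n}) (i : 'I_n).
Local Notation full v := (~: defects b v).

(** The monomials with truncation v are v times an arbitrary monomial y in the
    variables that are not defects of v. *)
Definition lift_full v (y : 'X_{1..#|full v|}) : 'X_{1..n} :=
  [multinom (v i + \sum_(j < #|full v| | enum_val j == i) y j)%N | i < n].

Lemma lift_full_in v y i (iF : i \in full v) :
  lift_full y i = (v i + y (enum_rank_in iF i))%N.
Proof.
rewrite mnmE; congr (_ + _)%N; apply: big_pred1 => j /=.
apply/eqP/eqP=> [eq_ji|->]; last exact: enum_rankK_in.
by apply: enum_val_inj; rewrite enum_rankK_in.
Qed.

Lemma lift_full_out v (y : 'X_{1..#|full v|}) i : i \notin full v -> lift_full y i = v i.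
Proof.
move=> iF; rewrite mnmE big_pred0 ?addn0 // => j; apply: contraNF iF => /eqP<-.
exact: enum_valP.
Qed.

Lemma mdeg_lift_full v (y : 'X_{1..#|full v|}) : mdeg (lift_full y) = (mdeg v + mdeg y)%N.
Proof.
rewrite !mdegE; under eq_bigr do rewrite mnmE; rewrite big_split /=; congr (_ + _)%N.
under eq_bigr do rewrite big_mkcond; rewrite exchange_big /=; apply: eq_bigr => j _.
by rewrite -big_mkcond /= (eq_bigl _ _ (eq_sym _)) big_pred1_eq.
Qed.

Lemma lift_full_inj v : injective (@lift_full v).
Proof.
move=> y z /mnmP eq_yz; apply/mnmP=> j.
have := eq_yz (enum_val j); rewrite !(lift_full_in _ (enum_valP j)) enum_valK_in.
by move/addnI.
Qed.

Lemma fiberP v m : (forall i, v i <= b i)%N ->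
  (trunc b m == v) = [exists y : 'X_{1..#|full v| < (mdeg m).+1}, m == lift_full y].
Proof.
move=> le_vb; apply/eqP/existsP=> [vE|[y /eqP->]].
  pose y := [multinom (m (enum_val j) - v (enum_val j))%N | j < #|full v|].
  have mE : m = lift_full y.
    apply/mnmP=> i; have [iF|iF] := boolP (i \in full v).
      rewrite (lift_full_in _ iF) mnmE enum_rankK_in // subnKC //.
      by rewrite -vE mnmE geq_minl.
    rewrite lift_full_out //; move: iF; rewrite -vE !inE negbK !mnmE.
    by rewrite gtn_min ltnn orbF => /ltnW/minn_idPl.
  have lt_y : (mdeg y < (mdeg m).+1)%N by rewrite mE mdeg_lift_full ltnS leq_addl.
  by exists (BMultinom lt_y); apply/eqP.
apply/mnmP=> i; rewrite mnmE; have [iF|iF] := boolP (i \in full v).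
  have le_bv : (b i <= v i)%N by move: (iF); rewrite !inE -leqNgt.
  rewrite (lift_full_in _ iF).
  have <- : v i = b i by apply/eqP; rewrite eqn_leq le_vb.
  by apply/minn_idPr; rewrite leq_addr.
by rewrite lift_full_out //; apply/minn_idPl.
Qed.

Lemma fiber_monos v t : (forall i, v i <= b i)%N -> (mdeg v <= t)%N ->
  count (fun m => trunc b m == v) (monos n t) = size (monos #|full v| (t - mdeg v)).
Proof.
move=> le_vb le_vt; rewrite -size_filter -(size_map (@lift_full v)).
apply/perm_size/uniq_perm; rewrite ?filter_uniq ?monos_uniq //.
  by rewrite (map_inj_uniq (@lift_full_inj v)) monos_uniq.
move=> m; rewrite mem_filter mem_monos fiberP //; apply/andP/mapP.
  case=> /existsP[y /eqP mE] /eqP mt; exists (y : 'X_{1.._}) => //.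
  by rewrite mem_monos -mt [X in (X - _)%N](congr1 (@mdeg n) mE) mdeg_lift_full addKn.
case=> y; rewrite mem_monos => /eqP yt mE.
have mt : mdeg m = t by rewrite mE mdeg_lift_full yt subnKC.
split; last exact/eqP.
have lt_y : (mdeg y < (mdeg m).+1)%N by rewrite mt yt ltnS leq_subr.
by apply/existsP; exists (BMultinom lt_y); apply/eqP.
Qed.

Lemma card_fiber_le v T : (forall i, v i <= b i)%N ->
  (#|[set m : 'X_{1..n < T.+1} | trunc b m == v]| <= T.+1 ^ #|full v|)%N.
Proof.
move=> le_vb; pose g (m : 'X_{1..n < T.+1}) :=
  [ffun j : 'I_#|full v| => inord (m (enum_val j)) : 'I_T.+1].
have -> : (T.+1 ^ #|full v|)%N = #|{ffun 'I_#|full v| -> 'I_T.+1}|.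
  by rewrite card_ffun !card_ord.
have g_inj : {in [set m : 'X_{1..n < T.+1} | trunc b m == v] &, injective g}.
  move=> x y; rewrite !inE => /eqP vx /eqP vy /ffunP gE; apply/val_inj/mnmP => i /=.
  have le_T (m : 'X_{1..n < T.+1}) : (m i <= T)%N.
    rewrite -ltnS; apply: leq_ltn_trans (bmdeg m); rewrite mdegE (bigD1 i) //=.
    exact: leq_addr.
  have [iF|] := boolP (i \in full v).
    have := gE (enum_rank_in iF i); rewrite !ffunE enum_rankK_in // => /(congr1 val) /=.
    by rewrite !inordK ?ltnS.
  move: (congr1 (fun m : 'X_{1..n} => m i) vx) (congr1 (fun m : 'X_{1..n} => m i) vy).
  by rewrite !inE negbK !mnmE; lia.
rewrite -(card_in_imset g_inj); exact: max_card.
Qed.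

End Fibers.

Section StandardCounts.
Variables (n : nat) (b : 'I_n -> nat) (U : pred 'X_{1..n}).
Implicit Types (m u v : 'X_{1..n}).
Hypothesis upU : forall m m', (m <= m')%MM -> U m -> U m'.
Hypothesis mingen_le : forall u i, mingen U u -> (u i <= b i)%N.
Local Notation full v := (~: defects b v).

Definition stdmons t : seq 'X_{1..n} := [seq m <- monos n t | ~~ U m].

Lemma trunc_le m i : (trunc b m i <= b i)%N.
Proof. by rewrite mnmE geq_minr. Qed.

(** Exactly one standard monomial is the truncation of m, unless m is in U. *)
Lemma sum_fibers m : (\sum_(v in standard b U) (trunc b m == v) = ~~ U m)%N.
Proof.
rewrite -(trunc_up upU mingen_le m); have [Um|Um] := boolP (U (trunc b m)).
  apply: big1 => v; rewrite inE => /andP[_ Uv].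
  by case: eqP => // vE; rewrite vE (negbTE Uv) in Um.
have [v vS ->] := standardP (trunc_le m) Um.
rewrite (bigD1 v) //= eqxx big1 // => w /andP[_ wv].
by rewrite -bmeqP eq_sym (negbTE wv).
Qed.

Lemma size_stdmons t : (\sum_i b i < t)%N ->
  size (stdmons t) = \sum_(v in standard b U) size (monos #|full v| (t - mdeg v)).
Proof.
move=> lt_t; rewrite size_filter.
transitivity (\sum_(m <- monos n t) \sum_(v in standard b U) (trunc b m == v))%N.
  by rewrite -sum1_count big_mkcond /=; apply: eq_bigr => m _; rewrite sum_fibers;
    case: (U m).
rewrite exchange_big /=; apply: eq_bigr => v vS.
rewrite -(@fiber_monos _ b).
- by rewrite -sum1_count [RHS]big_mkcond /=; apply: eq_bigr => m _; case: eqP.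
- by move: vS; rewrite inE => /andP[/forallP].
- by apply: ltnW; apply: leq_ltn_trans lt_t; rewrite -ltnS; apply: bmdeg.
Qed.

Variable h : nat.
Hypothesis min_defects : forall v : 'X_{1..n < _}, v \in standard b U ->
  (h <= #|defects b v|)%N.

Lemma card_full v : #|full v| = (n - #|defects b v|)%N.
Proof. by rewrite cardsCs setCK card_ord. Qed.

(** A monomial of degree at most T is determined by its truncation v and by at
    most n - h exponents, each at most T. *)
Lemma card_nonmembers_le T :
  (#|[set m : 'X_{1..n < T.+1} | ~~ U m]| <= #|standard b U| * T.+1 ^ (n - h))%N.
Proof.
apply: (@leq_trans (\sum_(v in standard b U) #|[set m : 'X_{1..n < T.+1} | trunc b m ==
  v]|)).
  under [X in (_ <= X)%N]eq_bigr => v _ do rewrite -sum1_card big_mkcond.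
  rewrite exchange_big /= -sum1_card big_mkcond; apply: leq_sum => m _ /=.
  rewrite inE (_ : (if _ then _ else _) = ~~ U m :> nat); last by case: (U m).
  by rewrite -sum_fibers; apply: leq_sum => v _; rewrite inE; case: eqP.
rewrite -sum_nat_const; apply: leq_sum => v vS.
apply: leq_trans (card_fiber_le _ _) _; first by move: vS; rewrite inE => /andP[/forallP].
by apply: leq_pexp2l => //; rewrite card_full leq_sub2l ?min_defects.
Qed.

End StandardCounts.

(** * Dimensions of subspaces of the quotient *)

Section Dimension.
Variables (K : fieldType) (n : nat) (I : idealr {mpoly K[n]}).
Hypothesis monI : monomial_ideal I.
Local Notation S := {mpoly K[n]}.
Local Notation R := {ideal_quot I}.
Local Notation pi := (\pi_R).

Lemma pi_eq0 (f : S) : (pi f == 0) = (f \in I).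
Proof. by rewrite -[f in RHS]subr0 Quotient.idealrBE -(rmorph0 pi). Qed.

Lemma pi_eq (f g : S) : (pi f = pi g) <-> (f - g \in I).
Proof. by rewrite Quotient.idealrBE; split=> [->//|/eqP]. Qed.

Section Basis.
Variables (N : nat) (e : 'I_N -> 'X_{1..n}).
Hypothesis e_inj : injective e.
Hypothesis e_std : forall j, ~~ mons I (e j).

Lemma std_independent (c : 'I_N -> K) :
  \sum_j pi (c j)%:MP * pi 'X_[e j] = 0 -> forall j, c j = 0.
Proof.
under eq_bigr do rewrite -rmorphM; rewrite -rmorph_sum => /eqP; rewrite pi_eq0 => fI j.
apply/eqP; apply: contraNT (e_std j) => cj; apply: monI fI _.
rewrite mcoeff_msupp raddf_sum (bigD1 j) //= mcoeffCM mcoeffX eqxx mulr1.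
rewrite big1 ?addr0 // => i ij; rewrite mcoeffCM mcoeffX.
by rewrite (inj_eq e_inj) (negbTE ij) mulr0.
Qed.

Lemma std_span (f : S) :
    (forall m, m \in msupp f -> mons I m \/ exists j, m = e j) ->
  pi f = \sum_j pi (f@_(e j))%:MP * pi 'X_[e j].
Proof.
move=> suppf; under eq_bigr do rewrite -rmorphM; rewrite -rmorph_sum.
apply/pi_eq/(monomial_idealP _ monI) => m; rewrite mcoeff_msupp.
apply: contraR => Im; rewrite mcoeffB raddf_sum /=.
under eq_bigr do rewrite mcoeffCM mcoeffX.
have [[j mE]|no] := classic (exists j, m = e j).
  rewrite (bigD1 j) //= mE eqxx mulr1 big1 ?addr0 ?subrr // => i ij.
  by rewrite (inj_eq e_inj) (negbTE ij) mulr0.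
rewrite big1 => [|j _]; last by case: eqP => [eq|]; rewrite ?mulr0 //; case: no; exists j.
rewrite subr0 -[_ == 0]negbK -mcoeff_msupp; apply/negP => /suppf[mI|//].
by rewrite mI in Im.
Qed.

(** The two bases are related by matrices A and B over K. Both products are
    identities: B A because the standard monomials are linearly independent
    modulo I, A B by the uniqueness of coordinates in the other basis. *)
Lemma is_dim_unique (V : R -> Prop) k :
    (forall j, V (pi 'X_[e j])) ->
    (forall x, V x -> exists c : {ffun 'I_N -> K}, x = \sum_j pi (c j)%:MP * pi 'X_[e j]) ->
  is_dim V k -> k = N.
Proof.
move=> Ve spanV [b [Vb spanb]].
have [A AE] := fin_all_exists (fun i => spanV (b i) (Vb i)).
have [B BE] : exists B : 'I_N -> {ffun 'I_k -> K},
    forall j, pi 'X_[e j] = \sum_i pi (B j i)%:MP * b i.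
  apply: (fin_all_exists (P := fun j (c : {ffun 'I_k -> K}) =>
     pi 'X_[e j] = \sum_i pi (c i)%:MP * b i)) => j.
  by have [c [cE _]] := spanb _ (Ve j); exists c.
pose MA := \matrix_(i < k, j < N) A i j.
pose MB := \matrix_(j < N, i < k) B j i.
have comp p q r (X : 'M[K]_(p, q)) (Y : 'M[K]_(q, r)) (z : 'I_r -> R) i :
    \sum_j pi (X i j)%:MP * (\sum_l pi (Y j l)%:MP * z l) =
    \sum_l pi ((X *m Y) i l)%:MP * z l.
  under eq_bigr do rewrite mulr_sumr; rewrite exchange_big /=; apply: eq_bigr => l _.
  rewrite mxE [in RHS]raddf_sum rmorph_sum mulr_suml; apply: eq_bigr => j _.
  by rewrite mulrA -!rmorphM.
have MAE i : b i = \sum_j pi (MA i j)%:MP * pi 'X_[e j].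
  by rewrite [LHS]AE; apply: eq_bigr => j _; rewrite mxE.
have MBE j : pi 'X_[e j] = \sum_i pi (MB j i)%:MP * b i.
  by rewrite [LHS]BE; apply: eq_bigr => i _; rewrite mxE.
have deltaE p (z : 'I_p -> R) i : z i = \sum_l pi ((1%:M : 'M[K]_p) i l)%:MP * z l.
  rewrite (bigD1 i) //= mxE eqxx rmorph1 rmorph1 mul1r big1 ?addr0 // => l li.
  by rewrite mxE eq_sym (negbTE li) !rmorph0 mul0r.
have BA1 : MB *m MA = 1%:M.
  apply/matrixP=> j l; apply/eqP; rewrite -subr_eq0; apply/eqP.
  apply: (std_independent (c := fun l => (MB *m MA) j l - 1%:M j l)).
  under eq_bigr do rewrite mpolyCB rmorphB mulrBl; rewrite sumrB -comp -deltaE.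
  by under eq_bigr do rewrite -MAE; rewrite -MBE subrr.
have AB1 : MA *m MB = 1%:M.
  apply/matrixP=> i l; have [c [_ uniq_c]] := spanb _ (Vb i).
  have eq1 : c = [ffun l => (MA *m MB) i l].
    apply: uniq_c; under [RHS]eq_bigr do rewrite ffunE.
    by rewrite -comp MAE; apply: eq_bigr => j _; rewrite -MBE.
  have eq2 : c = [ffun l => (1%:M : 'M[K]_k) i l].
    by apply: uniq_c; under [RHS]eq_bigr do rewrite ffunE; rewrite -deltaE.
  by move: (congr1 (fun c : {ffun 'I_k -> K} => c l) eq2); rewrite eq1 !ffunE.
by apply/eqP; rewrite eqn_leq (mulmx1_min AB1) (mulmx1_min BA1).
Qed.

End Basis.

Lemma dim_graded_part t k :
  is_dim (@graded_part _ _ I t) k -> k = size (stdmons (mons I) t).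
Proof.
set s := stdmons _ _; apply: (is_dim_unique (e := tnth (in_tuple s))).
- by apply/tuple_uniqP; rewrite filter_uniq ?monos_uniq.
- by move=> j; have := mem_tnth j (in_tuple s); rewrite mem_filter => /andP[].
- move=> j; exists 'X_[tnth (in_tuple s) j] => //; rewrite dhomogX.
  by have := mem_tnth j (in_tuple s); rewrite mem_filter mem_monos => /andP[_].
move=> _ [f /dhomogP hf ->]; exists [ffun j => f@_(tnth (in_tuple s) j)].
under eq_bigr do rewrite ffunE; apply: std_span => [|m mf].
  by apply/tuple_uniqP; rewrite filter_uniq ?monos_uniq.
have [|Im] := boolP (mons I m); [by left|right].
have /tnthP[j ->] : m \in in_tuple s; last by exists j.
by rewrite mem_filter Im mem_monos; apply/eqP/hf.
Qed.

End Dimension.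

(** * The Hilbert polynomial and the multiplicity *)

Section HilbertPolynomial.

Lemma poly_eq_eventually (p q : {poly rat}) t0 :
  (forall t : nat, (t0 <= t)%N -> p.[t%:R] = q.[t%:R]) -> p = q.
Proof.
move=> eq_pq; apply/eqP; rewrite -subr_eq0; apply: contraT => nz.
pose rs := [seq (t0 + i)%:R : rat | i <- iota 0 (size (p - q))].
have := max_poly_roots (rs := rs) nz; rewrite size_map size_iota ltnn => -> //.
  apply/allP=> _ /mapP[i _ ->]; rewrite /root hornerD hornerN eq_pq ?subrr //.
  exact: leq_addr.
rewrite map_inj_uniq ?iota_uniq // => i j /eqP; rewrite eqr_nat => /eqP.
exact: addnI.
Qed.

Lemma size_index_enum_ord d : size (index_enum 'I_d) = d.
Proof. by rewrite [index_enum _]unlock -enumT size_enum_ord. Qed.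

(** The polynomial binom(t - s + f - 1, f - 1) in t, read as 0 when f = 0. *)
Definition binomial_poly (f s : nat) : {poly rat} :=
  if f is f'.+1 then f'`!%:R^-1 *: \prod_(i < f') ('X - (s%:R + i%:R - f'%:R)%:P) else 0.

Lemma binomial_polyE f s t : (s < t)%N ->
  (binomial_poly f s).[t%:R] = (size (monos f (t - s)))%:R.
Proof.
move=> lt_st; case: f => [|f]; first by rewrite monos_no_var ?subn_gt0 // horner0.
rewrite size_monos_gt0 //= hornerZ horner_prod.
have nzf : (f`!%:R : rat) != 0 by rewrite pnatr_eq0 -lt0n fact_gt0.
apply: (mulfI nzf); rewrite mulVKf // -natrM mulnC bin_ffact ffact_prod natr_prod.
apply: eq_bigr => i _; rewrite hornerXsubC natrB; last by have := ltn_ord i; lia.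
by rewrite natrD natrB ?(ltnW lt_st) //; ring.
Qed.

Lemma coef_binomial_poly f s d : (f <= d.+1)%N ->
  (binomial_poly f s)`_d = (f == d.+1)%:R / d`!%:R.
Proof.
case: f => [|f] le_fd; first by rewrite coef0 mul0r.
rewrite /= coefZ mulrC eqSS; move: le_fd; rewrite ltnS leq_eqVlt => /predU1P[->|lt].
  rewrite eqxx; congr (_ / _).
  have := monicP (monic_prod_XsubC (index_enum 'I_d) xpredT (fun i : 'I_d => s%:R + i%:R
    - d%:R : rat)).
  by rewrite lead_coefE size_prod_XsubC size_index_enum_ord.
rewrite (ltn_eqF lt) mul0r nth_default ?mul0r //.
by rewrite size_prod_XsubC size_index_enum_ord.
Qed.

Lemma size_binomial_poly f s : (size (binomial_poly f s) <= f)%N.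
Proof.
case: f => [|f]; first by rewrite size_poly0.
by apply: leq_trans (size_scale_leq _ _) _; rewrite size_prod_XsubC size_index_enum_ord.
Qed.

End HilbertPolynomial.

Section Multiplicity.
Variables (K : fieldType) (n : nat) (I : idealr {mpoly K[n]}) (b : 'I_n -> nat).
Hypothesis monI : monomial_ideal I.
Hypothesis mingen_le : forall u i, mingen (mons I) u -> (u i <= b i)%N.
Local Notation std := (standard b (mons I)).
Variable h : nat.
Hypothesis min_defects : forall v : 'X_{1..n < _}, v \in std -> (h <= #|defects b v|)%N.
Definition extremal := [set v in std | #|defects b v| == h].

(** When h = n every variable is a defect of every standard monomial, so
    truncation is the identity outside U. *)
Lemma artinian_dim k : h = n -> is_dim (fun _ : {ideal_quot I} => True) k ->
  k = #|extremal|.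
Proof.
move=> hn; have all_def (v : 'X_{1..n < _}) i : v \in std -> (v i < b i)%N.
  move=> /min_defects; rewrite hn => le_n.
  have /setP/(_ i) : defects b v = setT.
    by apply/eqP; rewrite eqEcard subsetT cardsT card_ord.
  by rewrite !inE.
have -> : extremal = std.
  apply/setP=> v; rewrite inE; case: (boolP (v \in std)) => //= vS.
  rewrite eqn_leq min_defects // andbT hn.
  by have := max_card (mem (defects b v)); rewrite card_ord.
set s := enum std; rewrite cardE -/s.
have s_inj : injective (fun j => val (tnth (in_tuple s) j)).
  move=> i j /val_inj; have : uniq (in_tuple s) by apply: enum_uniq.
  by move/tuple_uniqP; apply.
apply: (is_dim_unique monI s_inj) => //.
  move=> j; have := mem_tnth j (in_tuple s); rewrite mem_enum inE.
  by case/andP.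
move=> x _; exists [ffun j => (repr x)@_(val (tnth (in_tuple s) j))].
rewrite -[LHS]reprK (std_span monI s_inj) => [|m _].
  by apply: eq_bigr => j _; rewrite ffunE.
have [|Im] := boolP (mons I m); [by left|right].
have Im' : ~~ mons I (trunc b m) by rewrite (trunc_up (@mons_up _ _ I) mingen_le).
have [v vS vE] := standardP (trunc_le b m) Im'.
have mE : m = v.
  apply/mnmP=> i; have := all_def v i vS; rewrite -vE mnmE; lia.
have /tnthP[j vj] : v \in in_tuple s by rewrite mem_enum.
by exists j; rewrite mE vj.
Qed.

Variable v0 : 'X_{1..n < (\sum_i b i).+1}.
Hypothesis v0_std : v0 \in std.
Hypothesis v0_def : #|defects b v0| = h.

(** The summand of a standard v has degree n - 1 minus its number of defects, so
    only the extremal ones contribute in the top degree. *)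
Lemma hilbert_poly_lead p d : is_hilbert_poly I p -> (n - h)%N = d.+1 ->
  d`!%:R * lead_coef p = #|extremal|%:R.
Proof.
case=> t0 hilb nh.
have le_f (v : 'X_{1..n < _}) : v \in std -> (#|~: defects b v| <= d.+1)%N.
  by move=> /min_defects; rewrite card_full; lia.
have pE : p = \sum_(v in std) binomial_poly #|~: defects b v| (mdeg v).
  apply: (@poly_eq_eventually _ _ (maxn t0 (\sum_i b i).+1)) => t.
  rewrite geq_max => /andP[le_t0 le_t]; have [k dimk ->] := hilb t le_t0.
  rewrite (dim_graded_part monI dimk) (size_stdmons (@mons_up _ _ I) mingen_le le_t).
  rewrite natr_sum horner_sum; apply: eq_bigr => v _; rewrite binomial_polyE //.
  by apply: leq_trans le_t; apply: bmdeg.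
have coefp : p`_d = #|extremal|%:R / d`!%:R.
  rewrite pE coef_sum.
  rewrite (eq_bigr (fun v : 'X_{1..n < _} => (#|~: defects b v| == d.+1)%:R / d`!%:R));
    last by move=> v vS; rewrite coef_binomial_poly ?le_f.
  rewrite -mulr_suml -natr_sum; congr (_%:R / _).
  rewrite -sum1_card big_mkcond [RHS]big_mkcond /=; apply: eq_bigr => v _.
  rewrite !inE; case: ifP => // vS; rewrite card_full.
  have := subset_leq_card (subsetT (defects b v)); rewrite cardsT card_ord.
  have : v \in std by rewrite inE.
  move=> /min_defects; case: (_ =P d.+1) => [|]; case: eqP => //=; lia.
have sizep : (size p <= d.+1)%N.
  rewrite pE; apply: leq_trans (size_sum _ _ _) _; apply/bigmax_leqP => v vS.
  exact: leq_trans (size_binomial_poly _ _) (le_f v vS).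
have nz : (d`!%:R : rat) != 0 by rewrite pnatr_eq0 -lt0n fact_gt0.
have coef_nz : p`_d != 0.
  rewrite coefp mulf_neq0 ?invr_eq0 // pnatr_eq0 -lt0n; apply/card_gt0P.
  by exists v0; rewrite inE v0_std v0_def eqxx.
have -> : lead_coef p = p`_d.
  rewrite lead_coefE; congr (_`_ _); apply/eqP; rewrite eqn_leq.
  rewrite -ltnS prednK ?size_poly_gt0; last by apply: contraNneq coef_nz => ->;
    rewrite coef0.
  rewrite sizep /= -ltnS prednK; last by rewrite size_poly_gt0;
    apply: contraNneq coef_nz => ->; rewrite coef0.
  by rewrite ltnNge; apply: contra coef_nz => /(nth_default 0)->.
by rewrite coefp mulrCA mulfV // mulr1.
Qed.

End Multiplicity.

(** * Krull dimension of a monomial quotient *)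

Section KillVariables.
Variables (K : fieldType) (n : nat).
Implicit Types (B : {set 'I_n}) (f : {mpoly K[n]}) (m : 'X_{1..n}).

Definition avoids B m : bool := [forall i in B, m i == 0%N].

(** Setting the variables in B to zero; its kernel is the prime ideal that they
    generate, prime because the polynomial ring is a domain. *)
Definition kill B : {mpoly K[n]} -> {mpoly K[n]} :=
  mmap (@mpolyC n K) (fun i => if i \in B then 0 else 'X_i).

HB.instance Definition _ B := GRing.RMorphism.on (kill B).

Lemma killX B m : kill B 'X_[m] = (avoids B m)%:R *: 'X_[m].
Proof.
rewrite /kill mmapX /mmap1; have [/forall_inP av|] := boolP (avoids B m).
  rewrite scale1r mpolyXE_id; apply: eq_bigr => i _.
  by case: ifP => // /av/eqP->; rewrite !expr0.
rewrite negb_forall_in => /exists_inP[i iB mi]; rewrite scale0r (bigD1 i) //= iB.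
by rewrite expr0n (negbTE mi) mul0r.
Qed.

Lemma mcoeff_kill B f m : (kill B f)@_m = if avoids B m then f@_m else 0.
Proof.
rewrite [in LHS](mpolyE f) rmorph_sum raddf_sum /=.
under eq_bigr => k _ do rewrite -mul_mpolyC rmorphM /= [kill B _%:MP]mmapC killX mcoeffCM
  mcoeffZ mcoeffX.
rewrite [in RHS](mpolyE f) raddf_sum /=.
under [in RHS]eq_bigr => k _ do rewrite mcoeffZ mcoeffX.
case: ifP => av; last first.
  by apply: big1 => k _; case: eqP => [->|_]; rewrite ?av ?mul0r ?mulr0.
by apply: eq_bigr => k _; case: eqP => [->|_]; rewrite ?av ?mul1r ?mulr0.
Qed.

Lemma kill_eq0 B f : (forall m, avoids B m -> f@_m = 0) <-> kill B f = 0.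
Proof.
split=> [f0|f0 m av].
  by apply/mpolyP=> m; rewrite mcoeff_kill mcoeff0; case: ifP => // /f0.
by have := mcoeff_kill B f m; rewrite av f0 mcoeff0.
Qed.

End KillVariables.

Section CoordinatePrimes.
Variables (K : fieldType) (n : nat) (I : idealr {mpoly K[n]}).
Hypothesis monI : monomial_ideal I.
Local Notation R := {ideal_quot I}.
Local Notation pi := (\pi_R).

Definition coord_prime (B : {set 'I_n}) : {pred R} := fun x => kill B (repr x) == 0.

Section Prime.
Variable B : {set 'I_n}.
Hypothesis coverB : forall m, mons I m -> ~~ avoids B m.

Lemma kill_ideal f : f \in I -> kill B f = 0.
Proof.
move=> fI; apply/kill_eq0 => m av; apply: contraTeq av.
by rewrite -mcoeff_msupp => /(monI fI)/coverB.
Qed.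

Lemma mem_coord_prime f : (pi f \in coord_prime B) = (kill B f == 0).
Proof.
rewrite unfold_in; have /kill_ideal : repr (pi f) - f \in I by apply/pi_eq; rewrite reprK.
by rewrite rmorphB => /eqP; rewrite subr_eq0 => /eqP->.
Qed.

Lemma coord_prime_prime : is_prime_ideal (coord_prime B).
Proof.
split.
  split=> [||x u v].
  - by rewrite -(rmorph0 pi) mem_coord_prime rmorph0.
  - by rewrite -(rmorph1 pi) mem_coord_prime rmorph1 oner_eq0.
  rewrite -[x]reprK -[u]reprK -[v]reprK -rmorphM -rmorphD !mem_coord_prime.
  by rewrite rmorphD rmorphM /= => /eqP-> /eqP->; rewrite mulr0 addr0.
move=> u v; rewrite -[u]reprK -[v]reprK -rmorphM !mem_coord_prime rmorphM.
by rewrite mulf_eq0.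
Qed.

End Prime.

Lemma avoids_subset (B C : {set 'I_n}) m : B \subset C -> avoids C m -> avoids B m.
Proof.
by move=> /subsetP sBC /forall_inP av; apply/forall_inP=> i /sBC; apply: av.
Qed.

(** If every monomial of I involves a variable of A, the variables of A generate a
    prime containing I, and adding the other variables one at a time lengthens
    the chain. *)
Lemma coordinate_chain (A : {set 'I_n}) :
  (forall m, mons I m -> ~~ avoids A m) -> exists P, @prime_chain R (n - #|A|) P.
Proof.
move=> coverA.
pose B k := A :|: [set i | (i \notin A) && (index i (enum (~: A)) < k)%N].
have coverB k m : mons I m -> ~~ avoids (B k) m.
  by move/coverA; apply: contra; apply: avoids_subset; apply: subsetUl.
have sB k : B k \subset B k.+1.
  by apply: setUS; apply/subsetP=> i; rewrite !inE => /andP[-> /=]; lia.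
exists (fun k => coord_prime (B k)); split=> k lt_k.
  exact: coord_prime_prime (@coverB k).
split=> [x|sub].
  rewrite -[x]reprK (mem_coord_prime (@coverB k)) (mem_coord_prime (@coverB k.+1)).
  move=> /eqP/kill_eq0 x0; apply/eqP/kill_eq0 => m av; apply: x0.
  exact: avoids_subset (sB k) av.
have size_A : size (enum (~: A)) = (n - #|A|)%N by rewrite -cardE cardsCs setCK card_ord.
have n_gt0 : (0 < n)%N by lia.
pose i := nth (Ordinal n_gt0) (enum (~: A)) k.
have iA : i \notin A.
  by have := mem_nth (Ordinal n_gt0) (_ : (k < size (enum (~: A)))%N);
    rewrite size_A => /(_ lt_k); rewrite mem_enum inE.
have i_idx : index i (enum (~: A)) = k by rewrite index_uniq ?enum_uniq ?size_A.
have mem_i l : (pi 'X_i \in coord_prime (B l)) = (k < l)%N.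
  have Xi0 : ('X_i == 0 :> {mpoly K[n]}) = false by rewrite -msize_poly_eq0 msizeX.
  transitivity (~~ avoids (B l) U_(i)%MM).
    rewrite (mem_coord_prime (@coverB l)) killX.
    by case: avoids; rewrite ?scale1r ?scale0r ?eqxx ?Xi0.
  rewrite negb_forall_in; apply/exists_inP/idP => [[j jB]|lt_kl].
    by rewrite mnm1E; case: (eqVneq i j) jB => [<-|//]; rewrite !inE (negbTE iA) /= i_idx.
  by exists i; rewrite ?mnm1E ?eqxx // !inE iA i_idx lt_kl orbT.
by have := sub (pi 'X_i); rewrite !mem_i ltnn => /(_ (ltnSn _)).
Qed.

End CoordinatePrimes.

Section ChainBound.
Variables (K : fieldType) (n : nat) (I : idealr {mpoly K[n]}).
Hypothesis monI : monomial_ideal I.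
Local Notation S := {mpoly K[n]}.
Local Notation R := {ideal_quot I}.
Local Notation pi := (\pi_R).

Definition independent_mod (P : {pred R}) (J : finType) (x : J -> S) : Prop :=
  forall c : J -> K, pi (\sum_j c j *: x j) \in P -> forall j, c j = 0.

(** In a relation whose terms are f^a y_a with y_a in the span of x, all terms
    with a > 0 lie in Q, hence so does y_0, which must vanish; then f can be
    cancelled because P is prime and does not contain it. *)
Lemma power_independent (P Q : {pred R}) (f : S) (J : finType) (x : J -> S) s :
    is_prime_ideal P -> is_prime_ideal Q -> {subset P <= Q} ->
    pi f \in Q -> pi f \notin P -> independent_mod Q x ->
  independent_mod P (fun aj : 'I_s * J => f ^+ aj.1 * x aj.2).
Proof.
move=> [idP primeP] [idQ _] sPQ fQ fP indep.
have [_ _ Plin] := idP; have [Q0 _ Qlin] := idQ.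
have claim r (c : nat -> J -> K) : pi (\sum_(a < r) f ^+ a * \sum_j c a j *: x j) \in P ->
    forall a, (a < r)%N -> forall j, c a j = 0.
  elim: r c => // r IH c; rewrite big_ord_recl expr0 mul1r.
  under [X in _ + X]eq_bigr => a _ do rewrite lift0 exprS -mulrA.
  rewrite -mulr_sumr rmorphD rmorphM => inP.
  have c0 j : c 0%N j = 0.
    apply: indep; have := sPQ _ inP; set y := (X in X + _ \in _ -> _); set z :=
      (X in y + _ * X \in _ -> _) => yzQ.
    rewrite -/y (_ : y = - z * pi f + (y + pi f * z));
      last by rewrite mulNr [z * _]mulrC addrC addrK.
    by apply: Qlin.
  case=> [|a] lt_ar j; first exact: c0.
  apply: (IH (fun a => c a.+1)) => //.
  move: inP; rewrite big1 => [|l _]; last by rewrite c0 scale0r.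
  by rewrite rmorph0 add0r => /primeP/orP[|//]; rewrite (negbTE fP).
move=> c inP [a j].
pose c' (b : nat) (j : J) := if insub b is Some b' then c (b', j) else 0.
have c'E (b : 'I_s) l : c' b l = c (b, l) by rewrite /c' valK.
rewrite -c'E; apply: (claim s c') => //.
rewrite [X in pi X](_ : _ = \sum_(p : 'I_s * J) c p *: (f ^+ p.1 * x p.2)) //.
under eq_bigr do rewrite mulr_sumr; rewrite pair_bigA /=.
by apply: eq_bigr => -[b l] _; rewrite c'E scalerAr.
Qed.

Lemma msize_mul_le (f g : S) : (msize (f * g) <= (msize f + msize g).-1)%N.
Proof.
have [->|f0] := eqVneq f 0; first by rewrite mul0r msize0.
have [->|g0] := eqVneq g 0; first by rewrite mulr0 msize0.
by rewrite msizeM.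
Qed.

(** Choosing an element of each prime of the chain outside the previous one, the
    products of their powers with exponents below s are independent modulo the
    first prime. *)
Lemma chain_independent d (P : nat -> {pred R}) : prime_chain d P ->
  exists D, forall s, exists (J : finType) (x : J -> S),
    [/\ #|J| = (s ^ d)%N, forall j, (msize (x j) <= (D * s).+1)%N & independent_mod (P
      0%N) x].
Proof.
elim: d P => [|d IH] P [primeP strictP].
  exists 0%N => s; exists unit, (fun _ => 1); split=> [|_|c].
  - by rewrite card_unit expn0.
  - by rewrite msize1.
  rewrite (big_pred1 tt) => [|[]//]; have [[P0 P1 Plin] _] := primeP 0%N (leqnn _).
  move=> cP []; apply: contraNeq P1 => nz.
  have -> : 1 = pi (c tt)^-1%:MP * pi (c tt *: 1) + 0.
    by rewrite addr0 -rmorphM mul_mpolyC scalerA mulVf // scale1r rmorph1.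
  by apply: Plin.
have [|D DP] := IH (fun k => P k.+1).
  by split=> k lt_k; [apply: primeP | apply: strictP].
have [sP nsP] := strictP 0%N (ltn0Sn _).
have [y yQ yP] : exists2 y, y \in P 1%N & y \notin P 0%N.
  apply: NNPP => no; case: nsP => y yQ; apply: contraT => yP; case: no; by exists y.
pose f := repr y; exists (D + msize f)%N => s.
have [J [x [cardJ sizex indepx]]] := DP s.
exists ('I_s * J)%type, (fun aj : 'I_s * J => f ^+ aj.1 * x aj.2); split.
- by rewrite card_prod card_ord cardJ expnS.
- case=> a j /=; apply: leq_trans (msize_mul_le _ _) _.
  have sizef r : (msize (f ^+ r) <= (msize f * r).+1)%N.
    elim: r => [|r IHr]; first by rewrite expr0 msize1.
    by rewrite exprS; apply: leq_trans (msize_mul_le _ _) _; rewrite mulnS; lia.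
  have := sizef a; have := sizex j; have : (msize f * a <= msize f * s)%N.
    by rewrite leq_mul2l (ltnW (ltn_ord a)) orbT.
  by rewrite mulnDl; lia.
by apply: (power_independent (Q := P 1%N)) => //; rewrite ?reprK //; apply: primeP.
Qed.

(** A family larger than the number of monomials outside I that can occur in it
    would have a nontrivial combination with no such monomial, that is, one
    lying in I. *)
Lemma independent_le (P : {pred R}) (J : finType) (x : J -> S) T :
    0 \in P -> (forall j, (msize (x j) <= T.+1)%N) -> independent_mod P x ->
  (#|J| <= #|[set m : 'X_{1..n < T.+1} | ~~ mons I m]|)%N.
Proof.
move=> P0 sizex indep; set M := [set m | _]; rewrite leqNgt; apply/negP => lt_MJ.
pose e (i : 'I_#|M|) : 'X_{1..n} := (enum_val i : 'X_{1..n < T.+1}).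
pose A : 'M[K]_(#|J|, #|M|) := \matrix_(j, i) (x (enum_val j))@_(e i).
have /rowV0Pn[c /sub_kermxP cA c0] : kermx A != 0.
  by rewrite -mxrank_eq0 mxrank_ker subn_eq0 -ltnNge (leq_ltn_trans (rank_leq_col A)).
case/eqP: c0; apply/rowP=> j; rewrite mxE.
have := indep (fun l => c 0 (enum_rank l)) _ (enum_val j); rewrite enum_valK; apply.
suff /eqP-> : pi (\sum_l c 0 (enum_rank l) *: x l) == 0 by [].
rewrite pi_eq0; apply/(monomial_idealP _ monI) => m; rewrite mcoeff_msupp.
apply: contraR => Im; rewrite raddf_sum /=; apply/eqP.
have [lt_m|le_m] := ltnP (mdeg m) T.+1; last first.
  apply: big1 => l _; rewrite mcoeffZ memN_msupp_eq0 ?mulr0 //.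
  by apply: msize_mdeg_ge; apply: leq_trans le_m.
have mM : BMultinom lt_m \in M by rewrite inE.
have /rowP/(_ (enum_rank_in mM (BMultinom lt_m))) := cA.
rewrite !mxE => sum0; rewrite -[RHS]sum0 (reindex (@enum_val _ J)) /=; last first.
  exact: onW_bij (enum_val_bij _).
by apply: eq_bigr => l _; rewrite mcoeffZ mxE enum_valK /e enum_rankK_in.
Qed.

Lemma power_growth d k C D :
  (forall s, s ^ d <= C * (D * s).+1 ^ k)%N -> (d <= k)%N.
Proof.
move=> growth; rewrite leqNgt; apply/negP => lt_kd.
pose s := (C * D.+1 ^ k).+1; have := growth s; rewrite leqNgt => /negP[].
apply: (@leq_ltn_trans (C * (D.+1 ^ k * s ^ k))).
  rewrite -expnMn leq_mul2l; apply/orP; right.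
  by case: (k) => // k'; rewrite leq_exp2r // mulSn addnC -addn1 leq_add2l.
apply: leq_trans (_ : s ^ k.+1 <= _)%N; last by rewrite leq_pexp2l.
by rewrite mulnA expnS ltn_mul2r expn_gt0 /=.
Qed.
End ChainBound.

Section KrullDimension.
Variables (K : fieldType) (n : nat) (I : idealr {mpoly K[n]}) (b : 'I_n -> nat).
Hypothesis monI : monomial_ideal I.
Hypothesis mingen_le : forall u i, mingen (mons I) u -> (u i <= b i)%N.
Local Notation std := (standard b (mons I)).
Variable h : nat.
Hypothesis min_defects : forall v : 'X_{1..n < _}, v \in std -> (h <= #|defects b v|)%N.
Variable v0 : 'X_{1..n < (\sum_i b i).+1}.
Hypothesis v0_std : v0 \in std.
Hypothesis v0_def : #|defects b v0| = h.

Lemma defects_cover m : mons I m -> ~~ avoids (defects b v0) m.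
Proof.
move=> mI; have [u gu le_um] := mingen_below mI; have /andP[uI _] := gu.
have : ~~ mons I v0 by move: v0_std; rewrite inE => /andP[].
apply: contra => /forall_inP av; apply: mons_up uI; apply/mnm_lepP=> i.
have [def_i|] := boolP (i \in defects b v0).
  by have := mnm_lepP le_um i; rewrite (eqP (av i def_i)) leqn0 => /eqP->.
by rewrite inE -leqNgt; apply: leq_trans; apply: mingen_le.
Qed.

Lemma krull_dimE d : is_krull_dim {ideal_quot I} d -> d = (n - h)%N.
Proof.
case=> [[P chainP] max_d]; apply/eqP; rewrite eqn_leq; apply/andP; split; last first.
  have [Q chainQ] := coordinate_chain monI defects_cover.
  by have := max_d _ _ chainQ; rewrite v0_def.
have [D indepD] := chain_independent chainP.
apply: (@power_growth _ _ #|std| D) => s.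
have [J [x [<- sizex indepx]]] := indepD s.
apply: leq_trans (card_nonmembers_le (@mons_up _ _ I) mingen_le min_defects _).
apply: (independent_le monI) indepx => //.
by have [/(_ 0%N (leq0n _)) [[]]] := chainP.
Qed.

End KrullDimension.

(** * The Koszul complex in characteristic zero *)

Section Reweight.
Variables (K : fieldType) (n : nat).
Local Notation S := {mpoly K[n]}.
Implicit Types (p a : S) (m : 'X_{1..n}).

(** Used with two kinds of weights: indicators of a degree, which give homogeneous
    components, and inverses of degrees, which invert Euler's operator. *)
Definition reweight (c : 'X_{1..n} -> K) p : S :=
  \sum_(m <- msupp p) (c m * p@_m) *: 'X_[m].

Lemma mcoeff_reweight c p m : (reweight c p)@_m = c m * p@_m.
Proof.
rewrite raddf_sum /=; under eq_bigr do rewrite mcoeffZ mcoeffX.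
have [mp|mp] := boolP (m \in msupp p).
  rewrite (bigD1_seq m) ?msupp_uniq //= eqxx mulr1 big1 ?addr0 // => k /negbTE->.
  by rewrite mulr0.
rewrite (memN_msupp_eq0 mp) mulr0 big1_seq // => k /= kp.
by case: eqP => [km|]; rewrite ?mulr0 // -km kp in mp *.
Qed.

Lemma reweight_is_linear c : linear (reweight c).
Proof.
move=> x p q; apply/mpolyP=> m.
by rewrite mcoeffD mcoeffZ !mcoeff_reweight mcoeffD mcoeffZ mulrDr mulrCA.
Qed.

HB.instance Definition _ c :=
  GRing.isLinear.Build K S S _ (reweight c) (reweight_is_linear c).

Lemma reweightX c m : reweight c 'X_[m] = c m *: 'X_[m].
Proof.
apply/mpolyP=> k; rewrite mcoeff_reweight mcoeffZ mcoeffX.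
by case: eqP => [->|]; rewrite ?mulr0.
Qed.

Lemma reweightM c c' p a :
    (forall m m', m' \in msupp a -> c (m + m')%MM = c' m) ->
  reweight c (p * a) = reweight c' p * a.
Proof.
move=> cE; rewrite (mpolyE p) mulr_suml !linear_sum /= mulr_suml.
apply: eq_bigr => m _; rewrite -scalerAl !linearZ /= reweightX -!scalerAl; congr (_ *: _).
rewrite {1 2}(mpolyE a) !mulr_sumr linear_sum scaler_sumr big_seq [RHS]big_seq /=.
apply: eq_bigr => m' m'a; rewrite -!scalerAr linearZ /= -mpolyXD reweightX cE //.
by rewrite !scalerA mulrC.
Qed.

Definition homog_part (d : int) : S -> S := reweight (fun m => ((mdeg m)%:Z == d)%:R).

HB.instance Definition _ d := GRing.Linear.on (homog_part d).

Lemma homog_part_homog d p : int_homog d (homog_part d p).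
Proof.
move=> m; rewrite mcoeff_msupp mcoeff_reweight.
by case: (_ =P d) => // _; rewrite mulr0n mul0r eqxx.
Qed.

Lemma homog_part_id d p : int_homog d p -> homog_part d p = p.
Proof.
move=> hp; apply/mpolyP=> m; rewrite mcoeff_reweight.
have [/hp->|mp] := boolP (m \in msupp p); first by rewrite eqxx mul1r.
by rewrite (memN_msupp_eq0 mp) mulr0.
Qed.

Lemma homog_partM d s p a : int_homog s a ->
  homog_part d (p * a) = homog_part (d - s) p * a.
Proof.
move=> ha; apply: reweightM => m m' /ha m's; congr (_%:R).
by rewrite mdegD PoszD m's eq_sym -subr_eq eq_sym.
Qed.

Lemma int_homogM d s p a : int_homog d p -> int_homog s a -> int_homog (d + s) (p * a).
Proof.
move=> hp ha m /msuppM_le/allpairsP[[m1 m2] /= [/hp <- /ha <- ->]].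
by rewrite mdegD.
Qed.

Lemma mcoeffXM k p m : ('X_k * p)@_m = if m k == 0%N then 0 else p@_(m - U_(k)).
Proof.
rewrite mulrC; case: ifP => mk; last first.
  rewrite -{1}(submK (_ : U_(k) <= m)%MM) ?lep1mP ?mk //.
  by rewrite addmC mcoeffMX.
apply: memN_msupp_eq0; rewrite (perm_mem (msuppMX _ _)).
apply/mapP => -[m' _ mE]; move: mk; rewrite mE mnmDE mnm1E eqxx.
by [].
Qed.

End Reweight.

Section Koszul.
Variables (K : fieldType) (n : nat).
Hypothesis charK : [pchar K] =i pred0.
Local Notation S := {mpoly K[n]}.
Local Notation chain := ({set 'I_n} -> S).
Implicit Types (A B : {set 'I_n}) (f g : chain) (k l : 'I_n).

Definition sgn k A : S := (-1) ^+ #|[set l in A | (l < k)%N]|.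

Lemma sgn_sq k A : sgn k A * sgn k A = 1.
Proof. by rewrite -expr2 sqrr_sign. Qed.

Lemma sgnU1 k l A : l \notin A -> sgn k (l |: A) = (-1) ^+ (l < k)%N * sgn k A.
Proof.
move=> lA; rewrite /sgn -exprD; congr (_ ^+ _).
have [lt_lk|le_kl] := ltnP l k.
  rewrite (_ : [set _ in _ | _] = l |: [set l' in A | (l' < k)%N]).
    by rewrite cardsU1 inE (negbTE lA) .
  by apply/setP=> i; rewrite !inE; case: eqP => [->|].
congr #|pred_of_set _|; apply/setP=> i; rewrite !inE; case: eqP => [->|//].
by rewrite (negbTE lA) /= ltnNge le_kl.
Qed.

(** The Koszul differential, a chain f being read as the sum of f A e_A. *)
Definition koszul f : chain := fun A =>
  \sum_(k | k \notin A) sgn k A * 'X_k * f (k |: A).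

(** The exterior derivative, for e_k read as the differential of x_k. *)
Definition cokoszul f : chain := fun A =>
  \sum_(k in A) sgn k (A :\ k) * (f (A :\ k))^`M(k).

Lemma sgn_anti k l A : k != l -> k \notin A -> l \notin A ->
  sgn k A * sgn l (k |: A) = - (sgn l A * sgn k (l |: A)).
Proof.
move=> kl kA lA; rewrite !sgnU1 //; move: (sgn k A) (sgn l A) => p q.
case: (ltngtP k l) => [lt|lt|/ord_inj eq]; last by rewrite eq eqxx in kl.
  by rewrite /= expr0 expr1; ring.
by rewrite /= expr0 expr1; ring.
Qed.

Lemma sgn_swap k l A : k != l -> k \notin A -> l \notin A ->
  sgn k (l |: A) * sgn l (k |: A) = - (sgn l A * sgn k A).
Proof.
move=> kl kA lA; rewrite !sgnU1 //; move: (sgn k A) (sgn l A) => p q.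
case: (ltngtP k l) => [lt|lt|/ord_inj eq]; last by rewrite eq eqxx in kl.
  by rewrite /= expr0 expr1; ring.
by rewrite /= expr0 expr1; ring.
Qed.

Lemma mderiv_sgn i k A p : (sgn k A * p)^`M(i) = sgn k A * p^`M(i).
Proof.
rewrite /sgn -signr_odd; case: odd; rewrite ?expr1 ?expr0 ?mul1r //.
by rewrite !mulN1r mderivN.
Qed.

Lemma koszul_koszul f A : koszul (koszul f) A = 0.
Proof.
pose T k l := if [&& k \notin A, l \notin A & k != l] then
  sgn k A * sgn l (k |: A) * ('X_k * 'X_l * f (l |: (k |: A))) else 0.
have E : koszul (koszul f) A = \sum_k \sum_l T k l.
  rewrite /koszul big_mkcond; apply: eq_bigr => k _.
  case: ifP => kA; last by rewrite big1 // => l _; rewrite /T kA.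
  rewrite mulr_sumr big_mkcond; apply: eq_bigr => l _;
    rewrite /T kA in_setU1 negb_or andbC eq_sym.
  by case: ifP => // _; ring.
have anti k l : T k l = - T l k.
  rewrite /T [in RHS]eq_sym (andbCA (l \notin A)); case: ifP => [/and3P[kA lA kl]|_];
    last by rewrite oppr0.
  by rewrite sgn_anti // mulNr ['X_k * _]mulrC setUCA.
have : koszul (koszul f) A *+ 2 = 0.
  rewrite mulr2n {1}E exchange_big /= E -big_split big1 //= => k _.
  by rewrite -big_split big1 //= => l _; rewrite anti addrC subrr.
move=> /(congr1 (mcoeff _)) eq0; apply/mpolyP=> m; have := eq0 m.
rewrite mcoeff0 mcoeffMn -mulr_natl => /eqP; rewrite mulf_eq0.
by have /pcharf0P-> := charK; move/eqP.
Qed.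

(** Euler's formula: on x^u e_A the anticommutator acts as multiplication by the
    degree of x^u plus the cardinality of A. *)
Lemma koszul_homotopy f A : koszul (cokoszul f) A + cokoszul (koszul f) A =
  \sum_k 'X_k * (f A)^`M(k) + (f A) *+ #|A|.
Proof.
pose T k l := sgn k A * sgn l (k |: (A :\ l)) * ('X_k * (f (k |: (A :\ l)))^`M(l)).
have E1 : koszul (cokoszul f) A =
    \sum_(k | k \notin A) 'X_k * (f A)^`M(k) + \sum_(k | k \notin A) \sum_(l in A) T k l.
  rewrite -big_split; apply: eq_bigr => k kA /=.
  rewrite /cokoszul (bigD1 k) ?setU11 //= setU1K // mulrDr; congr (_ + _).
    by rewrite mulrACA sgn_sq mul1r.
  rewrite mulr_sumr; apply: eq_big => [l|l /andP[]].
    by rewrite !inE; case: eqP => [->|]; rewrite ?(negbTE kA) ?andbT.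
  rewrite in_setU1 => /predU1P[->|lA lk]; first by rewrite eqxx.
  have -> : (k |: A) :\ l = k |: (A :\ l).
    by apply/setP=> i; rewrite !inE; case: (i =P k) => [->|//]; rewrite eq_sym lk.
  by rewrite mulrACA.
have E2 : cokoszul (koszul f) A =
    \sum_(k in A) 'X_k * (f A)^`M(k) + (f A) *+ #|A| - \sum_(l in A) \sum_(k | k \notin
      A) T k l.
  rewrite -sumr_const -big_split -sumrB; apply: eq_bigr => l lA /=.
  rewrite /koszul (bigD1 l) ?setD11 //= setD1K // mderivD mulrDr; congr (_ + _).
    rewrite -mulrA mderiv_sgn mulrA sgn_sq mul1r mderivM mderivX mnm1E eqxx scale1r.
    by rewrite (_ : U_(l) - U_(l) = 0)%MM ?mpolyX0 ?mul1r 1?addrC //; apply/mnmP=> i;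
      rewrite mnmBE subnn mnm0E.
  rewrite raddf_sum /= mulr_sumr -sumrN; apply: eq_big => [k|k /andP[]].
    by rewrite !inE; case: eqP => [->|]; rewrite ?lA ?andbT ?andbF.
  rewrite !inE negb_and negbK => /orP[/eqP->|kA kl]; first by rewrite eqxx.
  rewrite /T -[in sgn k A](setD1K lA) sgn_swap ?setD11 ?inE ?(negbTE kA) ?andbF //.
  rewrite -mulrA mderiv_sgn mderivM mderivX mnm1E (negbTE kl) scale0r mul0r add0r.
  by rewrite !mulNr opprK !mulrA.
rewrite E1 E2 exchange_big /= (bigID (mem A) xpredT) /=.
by move: (_ *+ _) => x; ring.
Qed.

(** Division of each term by its total degree; the term of degree 0 is sent to 0
    since 0 is its own inverse. *)
Definition invdeg f : chain := fun A => reweight (fun m => (mdeg m + #|A|)%:R^-1) (f A).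

Lemma koszul_invdeg f A : koszul (invdeg f) A =
  reweight (fun m => (mdeg m + #|A|)%:R^-1) (koszul f A).
Proof.
rewrite linear_sum; apply: eq_bigr => k kA /=.
rewrite [sgn k A * _ * f _]mulrAC (reweightM (c' := fun m => (mdeg m + #|A|.+1)%:R^-1));
  last first.
  move=> m m'; rewrite msuppX inE => /eqP->; congr (_%:R^-1).
  by rewrite mdegD mdeg1 addn1 addSnnS.
rewrite mulrAC; congr (_ * _); rewrite /invdeg cardsU1 kA add1n.
have -> : sgn k A = (((-1) ^+ #|[set l in A | (l < k)%N]|) : K)%:MP.
  by rewrite rmorphXn rmorphN1.
by rewrite !mul_mpolyC linearZ.
Qed.

Lemma koszul_exact f A :
    (forall l, l \in A -> koszul f (A :\ l) = 0) -> (A = set0 -> (f A)@_0 = 0) ->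
  koszul (cokoszul (invdeg f)) A = f A.
Proof.
move=> cyc f0; have := koszul_homotopy (invdeg f) A.
rewrite [cokoszul (koszul _) A]big1 ?addr0 => [->|l lA]; last first.
  by rewrite koszul_invdeg cyc // linear0 mderivC mulr0.
apply/mpolyP=> m; rewrite mcoeffD raddf_sum mcoeffMn /=.
under eq_bigr do rewrite mcoeffXM mcoeff_deriv.
rewrite (eq_bigr (fun k => (invdeg f A)@_m *+ m k)) => [|k _]; last first.
  case: eqP => [->|/eqP mk]; first by rewrite mulr0n.
  by rewrite submK ?lep1mP // mnmBE mnm1E eqxx subn1 prednK // lt0n.
rewrite sumrMnr -mdegE -mulrnDr mcoeff_reweight -[LHS]mulr_natl mulrA.
have [/eqP|nz] := eqVneq ((mdeg m + #|A|)%:R : K) 0; last by rewrite mulfV // mul1r.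
have /pcharf0P-> := charK; rewrite addn_eq0 mdeg_eq0 cards_eq0 => /andP[/eqP-> /eqP A0].
by rewrite f0 // mulr0.
Qed.

End Koszul.

(** * Transfer of Koszul classes to a graded free resolution *)

Section KoszulRows.
Variables (K : fieldType) (n : nat).
Hypothesis charK : [pchar K] =i pred0.
Local Notation S := {mpoly K[n]}.
Local Notation chain r := ({set 'I_n} -> 'rV[S]_r).
Implicit Types (A B : {set 'I_n}).

Definition koszul_row r (f : chain r) : chain r := fun A =>
  \sum_(k | k \notin A) (sgn K k A * 'X_k) *: f (k |: A).

Lemma koszul_row_coord r (f : chain r) A l :
  koszul_row f A 0 l = koszul (fun B => f B 0 l) A.
Proof. by rewrite summxE; apply: eq_bigr => k _; rewrite mxE. Qed.

Lemma koszul_row_row r (f : chain r) A : koszul_row (koszul_row f) A = 0.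
Proof.
apply/rowP=> l; rewrite koszul_row_coord mxE -[RHS](koszul_koszul charK (fun B => f B 0
  l) A).
by apply: eq_bigr => k _; rewrite koszul_row_coord.
Qed.

Lemma koszul_row_mul r s (f : chain r) (D : 'M[S]_(r, s)) A :
  koszul_row (fun B => f B *m D) A = koszul_row f A *m D.
Proof. by rewrite mulmx_suml; apply: eq_bigr => k _; rewrite scalemxAl. Qed.

Lemma koszul_rowB r (f g : chain r) A :
  koszul_row (fun B => f B - g B) A = koszul_row f A - koszul_row g A.
Proof. by rewrite -sumrB; apply: eq_bigr => k _; rewrite scalerBr. Qed.

Lemma koszul_row_eq r q (f g : chain r) A : #|A| = q ->
  (forall B, #|B| = q.+1 -> f B = g B) -> koszul_row f A = koszul_row g A.
Proof.
move=> cA eq_fg; apply: eq_bigr => k kA.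
by rewrite eq_fg // cardsU1 kA cA.
Qed.

(** Stated in a single exterior degree, which lets zigzags be chains that are
    unconstrained elsewhere. *)
Lemma koszul_row_exact r q (f : chain r) :
    (forall B, #|B| = q -> koszul_row f B = 0) ->
  exists f', forall A, #|A| = q.+1 -> f A = koszul_row f' A.
Proof.
move=> cyc; exists (fun A => \row_l cokoszul (invdeg (fun B => f B 0 l)) A) => A cA.
apply/rowP=> l; rewrite koszul_row_coord.
rewrite -(koszul_exact charK (f := fun B => f B 0 l)) => [|k kA|A0].
- by apply: eq_bigr => k _; rewrite mxE.
- rewrite -koszul_row_coord cyc ?mxE //.
  by have := cardsD1 k A; rewrite kA cA add1n => -[].
by rewrite A0 cards0 in cA.
Qed.

Lemma koszul_row_augmentation r (x : 'rV[S]_r) :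
  (forall l, (x 0 l)@_0 = 0) -> exists f, x = koszul_row f set0.
Proof.
move=> x0; exists (fun A => \row_l cokoszul (invdeg (fun=> x 0 l)) A).
apply/rowP=> l; rewrite koszul_row_coord.
rewrite -[LHS](koszul_exact charK (f := fun=> x 0 l) (A := set0)) => [|k|_ //].
  by apply: eq_bigr => k _; rewrite mxE.
by rewrite inE.
Qed.

End KoszulRows.

Section HomogeneousLift.
Variables (K : fieldType) (n : nat).
Local Notation S := {mpoly K[n]}.

(** The homogeneous component of the right degree of any solution is a solution. *)
Lemma homogeneous_lift r s (D : 'M[S]_(r, s)) (a : 'I_r -> int) (c : 'I_s -> int)
    (t : int) (v : 'rV[S]_s) (w : 'rV[S]_r) :
    (forall k l, int_homog (a k - c l) (D k l)) ->
    (forall l, int_homog (t - c l) (v 0 l)) -> v = w *m D ->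
  exists2 w' : 'rV[S]_r, v = w' *m D & forall k, int_homog (t - a k) (w' 0 k).
Proof.
move=> homD homv vE; exists (\row_k homog_part (t - a k) (w 0 k)) => [|k]; last first.
  by rewrite mxE; apply: homog_part_homog.
apply/rowP=> l; rewrite -(homog_part_id (homv l)) vE !mxE linear_sum.
apply: eq_bigr => k _; rewrite mxE /= (homog_partM _ _ (homD k l)).
by congr (homog_part _ _ * _); rewrite opprB addrA subrK.
Qed.

End HomogeneousLift.

Section Zigzag.
Variables (K : fieldType) (n : nat).
Hypothesis charK : [pchar K] =i pred0.
Variables (I : idealr {mpoly K[n]}) (F : graded_free_seq K n).
Hypothesis resF : is_graded_free_resolution I F.
Local Notation S := {mpoly K[n]}.
Local Notation chain r := ({set 'I_n} -> 'rV[S]_r).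
Implicit Types (A B : {set 'I_n}).
Local Notation d := (gf_diff F).

(** A class in the double complex of the Koszul complex and F, of total degree t,
    exterior degree q and homological degree p + 1: its image in F_p is a Koszul
    boundary, but it is not itself a sum of a Koszul boundary and an image from
    F_(p+2). *)
Definition zigzag (t : int) (q p : nat) (f : chain (gf_rank F p.+1)) : Prop :=
  [/\ forall A l, #|A| = q -> int_homog (t - q%:Z - gf_shift l) (f A 0 l),
      exists f0, forall A, #|A| = q -> f A *m d p = koszul_row f0 A
    & ~ exists g g', forall A, #|A| = q -> f A = koszul_row g A + g' A *m d p.+1].

Lemma diff_diff p (v : 'rV[S]_(gf_rank F p.+2)) : v *m d p.+1 *m d p = 0.
Proof. by have [_ [exF _]] := resF; apply/exF; exists v. Qed.

Lemma homog_koszul_row r (c : 'I_r -> int) (f : chain r) t q A :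
    (forall B l, #|B| = q.+1 -> int_homog (t - q.+1%:Z - c l) (f B 0 l)) -> #|A| = q ->
  forall l, int_homog (t - q%:Z - c l) (koszul_row f A 0 l).
Proof.
move=> homf cA l m; rewrite koszul_row_coord => /msupp_sum_le/flatten_mapP[k].
rewrite mem_filter => /andP[kA _]; rewrite -mulrA.
have -> : sgn K k A = (((-1) ^+ #|[set l in A | (l < k)%N]|) : K)%:MP.
  by rewrite rmorphXn rmorphN1.
rewrite mul_mpolyC => /msuppZ_le; have homX : int_homog 1 ('X_k : S).
  by move=> m'; rewrite msuppX inE => /eqP->; rewrite mdeg1.
have cB : #|k |: A| = q.+1 by rewrite cardsU1 kA cA.
move=> /(int_homogM homX (homf _ l cB)) ->; lia.
Qed.

Lemma lift_cycle t q (r : nat) (c : 'I_r ->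
  int) p (D : 'M[S]_(gf_rank F p, r)) (f : chain r) :
    (forall k l, int_homog (gf_shift k - c l) (D k l)) ->
    (forall A l, #|A| = q.+1 -> int_homog (t - q.+1%:Z - c l) (f A 0 l)) ->
    (forall A, #|A| = q -> exists w, koszul_row f A = w *m D) ->
  exists g : chain (gf_rank F p),
    (forall A l, #|A| = q -> int_homog (t - q%:Z - gf_shift l) (g A 0 l)) /\
    (forall A, #|A| = q -> g A *m D = koszul_row f A).
Proof.
move=> homD homf cyc.
have [g gP] : exists g : chain (gf_rank F p), forall A, #|A| = q ->
    (forall l, int_homog (t - q%:Z - gf_shift l) (g A 0 l)) /\ g A *m D = koszul_row f A.
  apply: (fin_all_exists (P := fun A (w : 'rV_(gf_rank F p)) => #|A| = q ->
    (forall l, int_homog (t - q%:Z - gf_shift l) (w 0 l)) /\ w *m D = koszul_row f A)) => A.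
  have [cA|ncA] := eqVneq #|A| q; last by exists 0 => cA; rewrite cA eqxx in ncA.
  have [w wE] := cyc A cA.
  have [w' wE' homw'] := homogeneous_lift homD (homog_koszul_row homf cA) wE.
  by exists w'.
by exists g; split=> A; [move=> l cA; have [] := gP A cA | move=> cA; have [] := gP A cA].
Qed.

(** The Koszul differential of f maps to zero in F_p, so it lifts to a chain g with
    values in F_(p+2). If g were trivial, f would differ from an image
    from F_(p+2) by a Koszul cycle in positive exterior degree, hence by a
    boundary. *)
Lemma zigzag_step t q p (f : chain (gf_rank F p.+1)) : zigzag t q.+1 f ->
  exists g : chain (gf_rank F p.+2), zigzag t q g.
Proof.
case=> homf [f0 f0E] nonf; have [homF [exF _]] := resF.
have cyc A : #|A| = q -> exists w, koszul_row f A = w *m d p.+1.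
  move=> cA; apply/exF; rewrite -koszul_row_mul.
  by rewrite (koszul_row_eq cA (g := koszul_row f0)) // koszul_row_row.
have [g [homg gE]] := lift_cycle (homF p.+1) homf cyc.
exists g; split=> //; first by exists f.
case=> g' [g'' gE']; apply: nonf.
have [|f' f'E] := @koszul_row_exact _ _ charK _ q (fun A => f A - g' A *m d p.+1).
  move=> A cA; rewrite koszul_rowB koszul_row_mul -gE // gE' // mulmxDl diff_diff addr0.
  by rewrite subrr.
by exists f', g' => A cA; rewrite -f'E // subrK.
Qed.

Lemma zigzag_descend t q p (f : chain (gf_rank F p.+1)) : zigzag t q f ->
  exists g : chain (gf_rank F (p + q).+1), zigzag t 0 g.
Proof.
elim: q p f => [|q IH] p f zf; first by rewrite addn0; exists f.
by have [g /IH] := zigzag_step zf; rewrite addSnnS.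
Qed.

(** In exterior degree 0 the values of Koszul boundaries are the vectors with
    coefficients in (x_1, ..., x_n), so reducing to constant terms turns a
    zigzag into a nonzero class in the homology of F (x) K. *)
Lemma zigzag_tor t p (f : chain (gf_rank F p.+1)) : zigzag t 0 f -> tor_dim F p.+1 t != 0%N.
Proof.
case=> homf [f0 f0E] nonf; pose x := f set0;
  have c0 : #|set0 : {set 'I_n}| = 0%N by rewrite cards0.
have mapM a b (A : 'M[S]_(a, b)) c (B : 'M[S]_(b, c)) :
    map_mx (mcoeff 0%MM) (A *m B) = map_mx (mcoeff 0%MM) A *m map_mx (mcoeff 0%MM) B.
  exact: map_mxM.
pose y := map_mx (mcoeff 0%MM) x.
have diff0 : (diff_tensor F p.+1 *m diff_tensor F p = 0)%MS.
  rewrite -mapM (_ : d p.+1 *m d p = 0) ?map_mx0 //; apply/row_matrixP=> k.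
  by rewrite [LHS]rowE mulmxA diff_diff row0.
have y_cycle : (y <= kermx (diff_tensor F p))%MS.
  apply/sub_kermxP; rewrite -mapM f0E //; apply/rowP=> l; rewrite !mxE koszul_row_coord.
  by rewrite raddf_sum big1 // => k _; rewrite /= -mulrA mulrCA mcoeffXM mnm0E eqxx.
have y_deg : (y <= degree_part F p.+1 t)%MS.
  apply/submxP; exists y; rewrite mul_mx_diag; apply/rowP=> l; rewrite !mxE.
  case: eqP => [|nt]; rewrite ?mulr1 ?mulr0 //.
  apply: memN_msupp_eq0; apply/negP => /(homf _ _ c0); rewrite mdeg0 => eq0.
  by apply: nt; lia.
have y_bound : ~~ (y <= diff_tensor F p.+1)%MS.
  apply/negP => /submxP[w yE]; apply: nonf.
  pose w' := map_mx (@mpolyC n K) w.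
  have wE : map_mx (mcoeff 0%MM) w' = w.
    by apply/rowP=> l; rewrite !mxE mcoeffC eqxx mulr1.
  have [|g gE] := koszul_row_augmentation charK (x := x - w' *m d p.+1).
    move=> l; have /rowP/(_ l) := yE; rewrite -{1}wE -mapM !mxE mcoeffB => ->.
    by rewrite subrr.
  by exists g, (fun=> w') => A /eqP; rewrite cards_eq0 => /eqP->; rewrite -gE subrK.
rewrite /tor_dim subn_eq0 -ltnNge; apply: rank_ltmx; rewrite ltmxE; apply/andP; split.
  rewrite sub_capmx capmxSr andbT; apply: submx_trans (capmxSl _ _) _.
  exact/sub_kermxP.
apply: contra y_bound => le_cyc.
have /submx_trans/(_ le_cyc) : (y <= cycles F p.+1 :&: degree_part F p.+1 t)%MS.
  by rewrite sub_capmx y_cycle.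
by rewrite sub_capmx => /andP[].
Qed.

End Zigzag.

(** * Koszul classes of minimal generators *)

Section KoszulClass.
Variables (K : fieldType) (n : nat).
Hypothesis charK : [pchar K] =i pred0.
Variables (I : idealr {mpoly K[n]}) (F : graded_free_seq K n).
Hypothesis monI : monomial_ideal I.
Hypothesis resF : is_graded_free_resolution I F.
Local Notation S := {mpoly K[n]}.
Local Notation R := {ideal_quot I}.
Local Notation pi := (\pi_R).
Local Notation chain r := ({set 'I_n} -> 'rV[S]_r).
Local Notation d := (gf_diff F).
Implicit Types (A B : {set 'I_n}) (z y : {set 'I_n} -> S).

(** The first step of the zigzag, from R to F_1: z times a lift v of 1 to F_0 is a
    chain whose Koszul differential is in the image of F_1. *)
Lemma koszul_class_tor t q z :
    (forall A, #|A| = q.+1 -> int_homog (t - q.+1%:Z) (z A)) ->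
    (forall B, #|B| = q -> koszul z B \in I) ->
    ~ (exists y, forall A, #|A| = q.+1 -> z A - koszul y A \in I) ->
  tor_dim F q.+1 t != 0%N.
Proof.
move=> homz cycz nonz; have [homF [exF [eps [homeps surj exeps]]]] := resF.
have [e eE] : exists e : 'I_(gf_rank F 0) ->
  S, forall k, int_homog (gf_shift k) (e k) /\ eps k = pi (e k).
  by apply: (fin_all_exists (P :=
    fun k f => int_homog (gf_shift k) f /\ eps k = pi f)) => k;
     have [f] := homeps k; exists f.
pose E (v : 'rV[S]_(gf_rank F 0)) : S := \sum_k v 0 k * e k.
have piE (v : 'rV[S]_(gf_rank F 0)) : \sum_k pi (v 0 k) * eps k = pi (E v).
  by rewrite rmorph_sum; apply: eq_bigr => k _; rewrite rmorphM (eE k).2.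
have E_exact v : (E v \in I) <-> exists w, v = w *m d 0.
  by rewrite -exeps piE -pi_eq0; split=> [/eqP|->].
have E_scale a v : E (a *: v) = a * E v.
  by rewrite mulr_sumr; apply: eq_bigr => k _; rewrite mxE mulrA.
have ED v w : E (v + w) = E v + E w.
  by rewrite -big_split; apply: eq_bigr => k _; rewrite mxE mulrDl.
have E_koszul (f : chain _) A : E (koszul_row f A) = koszul (fun B => E (f B)) A.
  rewrite /koszul_row /koszul; elim/big_rec2: _ => [|k a v _ <-];
    last by rewrite ED E_scale.
  by rewrite /E big1 // => k _; rewrite mxE mul0r.
(* The degree 0 part of any lift of 1 is again one, since I is homogeneous. *)
have [v homv Ev1] : exists2 v : 'rV[S]_(gf_rank F 0), forall l, int_homog (- gf_shift l)
  (v 0 l) & E v - 1 \in I.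
  have [w] := surj 1; rewrite piE -(rmorph1 pi) => /esym/pi_eq wI.
  exists (\row_l homog_part (- gf_shift l) (w 0 l)) => [l|].
    by rewrite mxE; apply: homog_part_homog.
  have -> : E (\row_l homog_part (- gf_shift l) (w 0 l)) - 1 = homog_part 0 (E w - 1).
    rewrite linearB /=; congr (_ - _).
      rewrite linear_sum; apply: eq_bigr => k _.
      by rewrite mxE /= (homog_partM _ _ (eE k).1) sub0r.
    rewrite homog_part_id // => m; rewrite -mpolyC1 msuppC oner_eq0 inE => /eqP->.
    by rewrite mdeg0.
  apply/(monomial_idealP _ monI) => m;
    rewrite mcoeff_msupp mcoeff_reweight mulf_eq0 negb_or.
  by case/andP=> _; rewrite -mcoeff_msupp; apply: monI.
have Ef A : E (z A *: v) - z A \in I.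
  by rewrite E_scale -{2}[z A]mulr1 -mulrBr; apply: idealMr.
have IE : forall w : 'rV_(gf_rank F 1), E (w *m d 0) \in I.
  by move=> w; apply/E_exact; exists w.
have koszul_ideal y A : (forall B, #|B| = #|A|.+1 -> y B \in I) -> koszul y A \in I.
  move=> yI; apply: rpred_sum => k kA; apply: idealMr; apply: yI.
  by rewrite cardsU1 kA.
have [|A l cA|A cA|g [homg gE]] :=
  @lift_cycle _ _ F t q _ (@gf_shift _ _ F 0) 1 (d 0) (fun A => z A *: v).
- exact: homF.
- rewrite mxE; apply: int_homogM; first exact: homz.
  exact: homv.
- apply/E_exact; rewrite E_koszul.
  have -> : koszul (fun B => E (z B *: v)) A = koszul (fun B => E (z B *: v) - z B) A +
    koszul z A.
    by rewrite -big_split; apply: eq_bigr => k _ /=; rewrite -mulrDr subrK.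
  by apply: rpredD; [apply: koszul_ideal => B _; apply: Ef | apply: cycz].
have : zigzag (F := F) t q (p := 0) g.
  split=> //; first by exists (fun A => z A *: v).
  case=> g' [g'' gE']; apply: nonz.
  have [|f' f'E] := @koszul_row_exact _ _ charK _ q (fun A => z A *: v - g' A *m d 0).
    move=> A cA; rewrite koszul_rowB koszul_row_mul -gE // gE' // mulmxDl.
    by rewrite (diff_diff resF) addr0 subrr.
  exists (fun A => E (f' A)) => A cA; rewrite -E_koszul -f'E //.
  have -> : z A - E (z A *: v - g' A *m d 0) = E (g' A *m d 0) - (E (z A *: v) - z A).
    have : E (z A *: v - g' A *m d 0) + E (g' A *m d 0) = E (z A *: v) by rewrite -ED subrK.
    by move=> <-; ring.
  by rewrite rpredB.
by move=> /(zigzag_descend charK resF)[h /(zigzag_tor charK resF)].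
Qed.

(** The chain is (x^u / x_m) e_(s + m). Its differential has the coefficient x^u at
    e_s up to sign, and x^u is not in (x_1, ..., x_n) I by minimality; whereas a
    boundary modulo I has there a differential with coefficients in that ideal,
    because the Koszul differential squares to zero. *)
Lemma generator_tor u (m : 'I_n) (s : {set 'I_n}) :
    mingen (mons I) u -> u m != 0%N ->
    (forall j, j \in s -> j != m /\ mons I (u - U_(m) + U_(j))%MM) ->
  tor_dim F #|s|.+1 (mdeg u + #|s|)%N%:Z != 0%N.
Proof.
move=> gu um sP; have ms : m \notin s by apply/negP => /sP[]; rewrite eqxx.
pose z A : S := if A == m |: s then 'X_[u - U_(m)] else 0.
have uE : (U_(m) + (u - U_(m)))%MM = u by rewrite addmC submK // lep1mP.
have /andP[uI /forallP minu] := gu.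
apply: (@koszul_class_tor _ _ z) => [A cA m'|B cB|[y yP]].
- rewrite /z; case: eqP => _; last by rewrite -mpolyC0 msupp0.
  by rewrite msuppX inE => /eqP->; have := mdeg_subU um; lia.
- apply: rpred_sum => k kB; rewrite /z -mulrA; case: eqP => [kBE|_]; last first.
    by rewrite !mulr0 rpred0.
  apply: idealMr; rewrite -mpolyXD; have : k \in m |: s by rewrite -kBE setU11.
  by rewrite in_setU1 => /predU1P[->|/sP[_]]; rewrite ?uE // addmC.
have : (koszul z s)@_u = (koszul (fun A => z A - koszul y A) s)@_u.
  congr (_@__); rewrite -[LHS]subr0 -[X in _ - X](koszul_koszul charK y s) -sumrB.
  by apply: eq_bigr => k _; rewrite mulrBr.
rewrite [RHS]raddf_sum [RHS]big1 => [|k ks] /=; last first.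
  rewrite -mulrA mulrCA mcoeffXM; case: eqP => // /eqP uk.
  have := yP (k |: s); rewrite cardsU1 ks => /(_ erefl) kI.
  apply: memN_msupp_eq0; apply/negP => mk.
  have /monI/(_ mk) : sgn K k s * (z (k |: s) - koszul y (k |: s)) \in I by apply: idealMr.
  by apply/negP; have := minu k; rewrite uk.
rewrite /koszul (bigD1 m) //= big1 ?addr0 => [|k /andP[ks km]]; last first.
  rewrite /z; case: eqP => [eqs|]; last by rewrite mulr0.
  have : k \in m |: s by rewrite -eqs setU11.
  by rewrite in_setU1 (negbTE km) (negbTE ks).
rewrite /z eqxx -mulrA -mpolyXD uE.
have -> : sgn K m s = (((-1) ^+ #|[set l in s | (l < m)%N]|) : K)%:MP.
  by rewrite rmorphXn rmorphN1.
by rewrite mcoeffCM mcoeffX eqxx mulr1 => /eqP; rewrite signr_eq0.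
Qed.

End KoszulClass.

(** * The multiplicity bound *)

Lemma binomial_rising d h : (0 < d)%N ->
  'C((d + h).-1, h)%:R = h`!%:R^-1 * \prod_(1 <= i < h.+1) (d + i.-1)%N%:R :> rat.
Proof.
move=> d_gt0; have nz : (h`!%:R : rat) != 0 by rewrite pnatr_eq0 -lt0n fact_gt0.
apply: (mulfI nz); rewrite mulVKf // -natrM mulnC bin_ffact ffact_prod natr_prod.
rewrite big_add1 big_mkord (reindex_inj rev_ord_inj) /=; apply: eq_bigr => i _.
by congr (_%:R); have := ltn_ord i; lia.
Qed.

Lemma subset_of_card (T : finType) (A : {set T}) k : (k <= #|A|)%N ->
  exists2 B : {set T}, B \subset A & #|B| = k.
Proof.
move=> /card_geqP[s [us <- sA]]; exists [set x in s].
  by apply/subsetP=> x; rewrite inE => /sA.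
by rewrite cardsE; apply/card_uniqP.
Qed.

Section StableIdealBounds.
Variables (K : fieldType) (n : nat) (a : 'I_n -> option nat) (I : idealr {mpoly K[n]}).
Hypothesis stabI : stable_ideal a I.

Lemma stable_monomial : monomial_ideal I.
Proof. by have [_ [G [genG _] _]] := stabI; apply: generated_monomial_ideal genG. Qed.

(** For a finite a_i the bound is a_i - 1; for an infinite one it exceeds all
    exponents of minimal generators, so that it is never reached and the exchange
    condition holds at every exponent below it. *)
Lemma stable_bounds : exists b : 'I_n -> nat,
  (forall u i, mingen (mons I) u -> (u i <= b i)%N) /\
  (forall u (k j : 'I_n), mingen (mons I) u -> is_max_var u k -> (j < k)%N ->
    (u j < b j)%N ->
     mons I (u - U_(k) + U_(j))%MM).
Proof.
have [[G1 minG1 boundG1] [G2 minG2 stabG2]] := stabI.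
have [D DP] := dickson (U := mons I) (@mons_up _ _ I).
exists (fun i => if a i is Some ai then ai.-1 else D.+1);
  split=> [u i gu|u k j gu uk lt_jk lt_j].
  have := boundG1 u; rewrite (minimal_generatorsE minG1) => /(_ gu i).
  case: (a i) => [ai|_] /=; first by lia.
  have /andP[uI _] := gu; have /DP capI := uI.
  have <- : cap D u = u.
    by apply: (mingen_minimal (@mons_up _ _ I)) => //; apply/mnm_lepP=> l;
      rewrite mnmE geq_minl.
  by rewrite mnmE; lia.
apply: (stabG2 u) => //; rewrite ?(minimal_generatorsE minG2) ?(ltnW lt_jk) //.
by move: lt_j; case: (a j).
Qed.

End StableIdealBounds.

Theorem corollary3p10 (K : fieldType) (n : nat) (a : 'I_n -> option nat)
    (I : idealr {mpoly K[n]}) (c : nat) (e : rat) (M : nat -> int)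
    (charK : [pchar K] =i pred0)
    (ha : forall i, bound_ge2 (a i))
    (hI : stable_ideal a I)
    (hc : is_codim I c)
    (he : is_multiplicity I e)
    (hM : forall i, (1 <= i <= c)%N -> is_max_shift I i (M i)) :
  e <= (c`!)%:R^-1 * \prod_(1 <= i < c.+1) (M i)%:~R.
Proof.
have monI := stable_monomial hI.
have upI := @mons_up _ _ I.
have [b [mingen_le exchange]] := stable_bounds hI.
pose std := standard b (mons I).
pose z : 'X_{1..n < (\sum_i b i).+1} := BMultinom (bm0_proof n (\sum_i b i)%N).
have std0 : z \in std.
  rewrite inE; apply/andP; split; first by apply/forallP=> i; rewrite mnm0E.
  by rewrite /mons mpolyX0 idealr1.
pose v0 := [arg min_(v < z in std) #|defects b v|].
have [v0_std min_v0] : v0 \in std /\ forall v, v \in std ->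
  (#|defects b v0| <= #|defects b v|)%N.
  by rewrite /v0; case: arg_minnP.
pose h := #|defects b v0|.
have dimE d : is_krull_dim {ideal_quot I} d -> d = (n - h)%N.
  exact: (krull_dimE monI mingen_le min_v0 v0_std).
have le_hn : (h <= n)%N by have := max_card (mem (defects b v0)); rewrite card_ord.
have ch : c = h by have [d /dimE -> ] := hc; lia.
have eE : e = #|extremal I b h|%:R.
  have [d /dimE dE] := he; case: d dE => [|d] dE.
    by case=> k /(artinian_dim monI mingen_le min_v0) -> //; lia.
  case=> p hp ->.
  by rewrite (hilbert_poly_lead monI mingen_le min_v0 v0_std erefl hp).
move: hM; rewrite {}eE ch => hM.
have ext_box (v : 'X_{1..n < _}) : v \in extremal I b h ->
    [/\ forall i, (v i <= b i)%N, ~~ mons I v & #|defects b v| = h].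
  by rewrite !inE => /andP[/andP[/forallP vb Iv] /eqP vh].
have min_h (w : 'X_{1..n}) : (forall i, w i <= b i)%N -> ~~ mons I w ->
  (h <= #|defects b w|)%N.
  by move=> wb Iw; have [v vS ->] := standardP wb Iw; apply: min_v0.
(* For h = 0 the only monomial that can be counted is b itself. *)
have [h0|h_gt0] := posnP h.
  have -> : h`!%:R^-1 * \prod_(1 <= i < h.+1) (M i)%:~R = 1 :> rat.
    by rewrite h0 big_geq // mulr1 invr1.
  rewrite -[1]/(1%:R) ler_nat; apply: (@leq_trans 'C((0 + h).-1, h)); last by rewrite h0.
  apply: card_prefix_bounded => [v /ext_box[]//|v k /ext_box[_ _ vh] kv _].
  by move: kv; rewrite (cards0_eq (etrans vh h0)) inE.
have last_defect (v : 'X_{1..n}) : #|defects b v| = h ->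
    exists2 k, k \in defects b v & forall i, i \in defects b v -> (i <= k)%N.
  move=> vh; have [i0 i0v] : exists i, i \in defects b v by apply/card_gt0P; rewrite vh.
  by case: (@arg_maxnP _ i0 (mem (defects b v)) (fun k : 'I_n => k : nat) i0v) => k;
    exists k.
have [v0b Iv0 _] : [/\ forall i, (v0 i <= b i)%N, ~~ mons I v0 & #|defects b v0| = h].
  by apply: ext_box; rewrite inE v0_std eqxx.
(* Good generators exist because there is a standard monomial with h defects, and
   they lie in the finite box below b. *)
have [u gu max_u] : exists2 u, good b (mons I) h u &
    forall u', good b (mons I) h u' -> (mdeg u' <= mdeg u)%N.
  have [k0 k0v k0_max] := last_defect v0 erefl.
  have box_good u : good b (mons I) h u ->
    exists2 w : 'X_{1..n < (\sum_i b i).+1}, good b (mons I) h w & u = w.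
    by move=> gu; have [/mingen_le ub _] := andP gu; exists (BMultinom (mem_box ub)).
  have [u /box_good[w gw _]] := exists_good upI min_h v0b Iv0 erefl k0v k0_max.
  case: (@arg_maxnP _ w (fun u : 'X_{1..n < _} => good b (mons I) h u) (fun u => mdeg u)
    gw) => u1 gu1 max_u1.
  by exists u1 => // u' /box_good[w' gw' ->]; apply: max_u1.
have [gen_u /existsP[m /and3P[um /forallP max_m card_m]]] := andP gu.
have le_M i : (1 <= i <= h)%N -> (mdeg u + i.-1)%N%:Z <= M i.
  move=> /andP[i_gt0 le_ih]; have [[b' [F resF _] _] max_M] :=
    hM i (introT andP (conj i_gt0 le_ih)).
  have [|s sub_s card_s] := @subset_of_card _ [set j in defects b u | (j < m)%N] i.-1;
    first by lia.
  apply: max_M; have := generator_tor charK monI resF gen_u um (s := s).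
  rewrite card_s prednK // => tor; exists (tor_dim F i (mdeg u + i.-1)%N%:Z);
    first by exists F.
  apply: tor => j /(subsetP sub_s); rewrite !inE => /andP[lt_j lt_jm]; split.
    by apply: contraTneq lt_jm => ->; rewrite ltnn.
  apply: exchange gen_u _ lt_jm lt_j; split=> // k uk.
  by have := max_m k; rewrite uk.
have d_gt0 : (0 < mdeg u)%N by rewrite -(mdeg_subU um).
apply: (@le_trans _ _ ('C((mdeg u + h).-1, h)%:R : rat)).
  rewrite ler_nat; apply: card_prefix_bounded => [v /ext_box[]//|v k /ext_box[vb Iv vh]
    kv k_max].
  exact: (prefix_bound upI exchange min_h vb Iv vh kv k_max max_u).
rewrite binomial_rising // ler_pM2l ?invr_gt0 ?ltr0n ?fact_gt0 //.
rewrite big_nat_cond [leRHS]big_nat_cond; apply: ler_prod => i /andP[/andP[i1 ih] _].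
by rewrite ler0n /= pmulrn ler_int le_M // i1 -ltnS.
Qed.
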